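(* Let $\Delta$ be a finite set of first-order insertion queries over the graph schema $\{E\}$. Then the dynamic query $(q_{\mathrm{Reach}}, \Delta \cup \Delta_E)$ can be maintained in DynFO for undirected graphs.
   Context: Framework. A schema $\tau$ consists of relation symbols with arities and constant symbols; a database over $\tau$ with a finite domain $D$ interprets them. A replacement rule for a relation symbol $R$ is $R := \mu_R(\bar p;\bar x)$, where $\mu_R$ is a first-order formula over $\tau$, $\bar x$ has the arity of $R$, and $\bar p$ is a tuple of parameter variables. A replacement query $\rho(\bar p)$ is a set of replacement rules for distinct relation symbols, all with the same parameter tuple $\bar p$; it is parameter-free if $\bar p$ is empty, and quantifier-free (resp. existential, i.e. in $\mathrm{FO}[\exists^*]$) if all its formulas are. A change $\delta=\rho(\bar a)$ consists of a replacement query $\rho$ and a tuple $\bar a$ of domain elements of the arity of $\bar p$; $\delta(\mathcal D)$ is obtained from $\mathcal D$ by replacing every relation $R$ having a rule in $\rho$ by $\{\bar b : \mathcal D\models \mu_R(\bar a;\bar b)\}$. An insertion query is one in which every $\mu_R$ has the form $R(\bar x)\lor\varphi_R$; a deletion query one in which every $\mu_R$ has the form $R(\bar x)\land\varphi_R$. The single-tuple insertion $\mathrm{ins}_R(\bar p)$ is $R:=R(\bar x)\lor \bar x=\bar p$, the single-tuple deletion $\mathrm{del}_R(\bar p)$ is $R:=R(\bar x)\land\neg(\bar x=\bar p)$; $\Delta_\tau$ is the set of all single-tuple insertions and deletions for the relation symbols of $\tau$ ($\Delta_E$ for graphs with edge relation $E$). A dynamic program with input schema $\tau_{in}$ and auxiliary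 schema $\tau_{aux}$ operates on states $(D,\mathcal I,\mathcal A)$ consisting of an input database $\mathcal I$ and an auxiliary database $\mathcal A$ over a common fixed finite domain $D$. For every allowed replacement query $\rho(\bar p)$ and every auxiliary symbol $T$ it has an update formula $\varphi_T(\bar p;\bar x)$ over $\tau_{in}\cup\tau_{aux}$. On a change $\delta=\rho(\bar a)$ the new state has input $\delta(\mathcal I)$ and each $T$ becomes $\{\bar b : (\mathcal I,\mathcal A)\models\varphi_T(\bar a,\bar b)\}$, evaluated in the old state. A dynamic query is a pair $(q,\Delta)$ of a query $q$ and a set $\Delta$ of replacement queries. A program maintains $(q,\Delta)$, $q$ of arity $k$, if it has a $k$-ary auxiliary relation $Q$ such that for every domain, starting from the empty input and empty auxiliary database, after every nonempty sequence $\alpha$ of changes from $\Delta$ the relation $Q$ equals $q(\alpha(\mathcal I_\emptyset))$. DynFO is the class of dynamic queries maintainable with first-order update formulas; DynProp with quantifier-free update formulas. When maintenance is ''for'' a class of inputs, only change sequences all of whose intermediate inputs lie in that class are considered. Graphs are structures with one binary relation $E$; $q_{\mathrm{Reach}}$ maps a graph to the set of pairs $(u,v)$ such that there is a path from $u$ to $v$. For undirected graphs, modifications are symmetric: whenever an edge $(a,b)$ is inserted (deleted), so is $(b,a)$. *)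

(* Defs.v *)
From Stdlib Require List.
From mathcomp Require Import all_boot.
Set Implicit Arguments. Unset Strict Implicit. Unset Printing Implicit Defensive.

(* First-order logic over a relational schema with relation symbols of type *)
(* S (no constant symbols: neither {E} nor the auxiliary schemas have any).  *)
(* Variables are de Bruijn indices: variable i denotes the i-th entry of the *)
(* environment; a quantifier pushes the quantified element in front.        *)
Inductive fo (S : Type) : Type :=
| FRel of S & seq nat
| FEq of nat & nat
| FNot of fo S
| FAnd of fo S & fo S
| FOr of fo S & fo S
| FEx of fo S
| FAll of fo S.
Arguments FRel {S}. Arguments FEq {S}. Arguments FNot {S}. Arguments FAnd {S}.
Arguments FOr {S}. Arguments FEx {S}. Arguments FAll {S}.

Section Semantics.
Variables (S : Type) (D : finType) (I : S -> seq D -> bool).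

Fixpoint lookup_all (env : seq D) (args : seq nat) : option (seq D) :=
  match args with
  | [::] => Some [::]
  | i :: a => match onth env i, lookup_all env a with
              | Some d, Some t => Some (d :: t)
              | _, _ => None
              end
  end.

Fixpoint eval (env : seq D) (f : fo S) : bool :=
  match f with
  | FRel r args => if lookup_all env args is Some t then I r t else false
  | FEq i j => match onth env i, onth env j with
               | Some a, Some b => a == b
               | _, _ => false
               end
  | FNot g => ~~ eval env g
  | FAnd g h => eval env g && eval env h
  | FOr g h => eval env g || eval env h
  | FEx g => [exists d : D, eval (d :: env) g]
  | FAll g => [forall d : D, eval (d :: env) g]
  end.
End Semantics.

(* The graph schema {E}: a single binary symbol, named tt. *)
Definition graph_interp (D : finType) (E : rel D) : unit -> seq D -> bool :=
  fun _ t => if t is [:: x; y] then E x y else false.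

(* A replacement query over {E} with parameter tuple of arity rq_ar:        *)
(* either no rule, or a rule  E := mu(p_1..p_k ; x_1, x_2)  where mu is     *)
(* evaluated in the environment p_1..p_k, x_1, x_2 (indices 0..k+1).        *)
Record rquery := RQ { rq_ar : nat; rq_rule : option (fo unit) }.

Definition apply_rq (q : rquery) (D : finType) (a : seq D) (E : rel D) : rel D :=
  if rq_rule q is Some mu then fun x y => eval (graph_interp E) (a ++ [:: x; y]) mu
  else E.

Definition is_insertion (q : rquery) : Prop :=
  match rq_rule q with
  | None => True
  | Some mu => exists phi, mu = FOr (FRel tt [:: rq_ar q; (rq_ar q).+1]) phi
  end.

(* Symmetric (undirected) single-edge modifications: parameters p1 p2 are   *)
(* variables 0 1, x1 x2 are variables 2 3.                                  *)
Definition edge_or_rev : fo unit :=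
  FOr (FAnd (FEq 2 0) (FEq 3 1)) (FAnd (FEq 2 1) (FEq 3 0)).
Definition insE : rquery := RQ 2 (Some (FOr (FRel tt [:: 2; 3]) edge_or_rev)).
Definition delE : rquery := RQ 2 (Some (FAnd (FRel tt [:: 2; 3]) (FNot edge_or_rev))).

Definition dummy_rq : rquery := RQ 0 None.

(* Dynamic programs with input schema {E}, for a list qs of allowed         *)
(* replacement queries (indexed by 'I_nq, nq = size qs).  The auxiliary      *)
(* schema has dp_m relation symbols with arities dp_ar; for every allowed    *)
(* query j and aux symbol T there is a first-order update formula            *)
(* dp_upd j T over {E} + aux, evaluated in the environment  a ++ b  (the     *)
(* parameters, then the tuple).  dp_Q is the designated query relation.      *)
Record dynprog (nq : nat) := DynProg {
  dp_m : nat;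
  dp_ar : 'I_dp_m -> nat;
  dp_upd : 'I_nq -> 'I_dp_m -> fo (unit + 'I_dp_m)%type;
  dp_Q : 'I_dp_m;
  dp_Qar : dp_ar dp_Q = 2
}.

Section Run.
Variables (qs : seq rquery) (P : dynprog (size qs)) (D : finType).

Definition aux_db := 'I_(dp_m P) -> seq D -> bool.
Definition state := (rel D * aux_db)%type.

Definition prog_interp (E : rel D) (A : aux_db) : (unit + 'I_(dp_m P))%type -> seq D -> bool :=
  fun s t => match s with inl _ => graph_interp E tt t | inr i => A i t end.

(* A change rho_j(a); the new aux relations are evaluated in the old state. *)
Definition step (st : state) (c : 'I_(size qs) * seq D) : state :=
  let: (E, A) := st in
  let: (j, a) := c in
  (apply_rq (nth dummy_rq qs j) a E,
   fun i t => (size t == @dp_ar _ P i) && eval (prog_interp E A) (a ++ t) (@dp_upd _ P j i)).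

Definition empty_state : state := (fun _ _ => false, fun _ _ => false).

Definition run (alpha : seq ('I_(size qs) * seq D)) : state := foldl step empty_state alpha.
End Run.

Definition reach (D : finType) (E : rel D) (t : seq D) : bool :=
  if t is [:: u; v] then connect E u v else false.

Definition maintains_reach_undirected (qs : seq rquery) (P : dynprog (size qs)) : Prop :=
  forall (D : finType) (alpha : seq ('I_(size qs) * seq D)),
    0 < size alpha ->
    (forall c, List.In c alpha -> size c.2 = rq_ar (nth dummy_rq qs c.1)) ->
    (forall n, n <= size alpha -> symmetric (run P (take n alpha)).1) ->
    forall t, (run P alpha).2 (dp_Q P) t = reach (run P alpha).1 t.

Definition DynFO_reach_undirected (qs : seq rquery) : Prop :=
  exists P : dynprog (size qs), maintains_reach_undirected P.

(* Main.v *)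
(** Call an element touched once it has been a parameter of a change.  The
    untouched elements stay pairwise indistinguishable, so it suffices to
    maintain a linear order of the touched elements and a spanning forest of
    the graph they induce.  The forest is stored through the relation "x is on
    a's side of the forest edge ab", which makes cutting an edge definable;
    re-linking trees is definable as long as all links chosen at once lead into
    a set of trees that are not themselves linked to each other.

    A first-order insertion merges trees.  If a shortest sequence of new edges
    joining two trees is long, two of its trees contain no parameter and are
    entered at vertices of the same rank-r type; exchanging these two trees is
    invisible to a formula of rank r, which yields a shortcut.  Hence all
    merging is within a bounded distance, and boundedly many rounds of linking,
    starting from the tree of the least vertex of each new component, rebuild
    a spanning forest. *)

(* First-order formulas cannot iterate, and the construction answers this at three points. Choosing
   among candidate edges needs an order; since the auxiliary database starts empty, only elements
   already named by a change can be ordered. Connectedness after linking must be one fixed formula: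
   if each linked tree has a single link, ending in a tree that is not linked itself, two links
   suffice to join any two connected vertices. Finally, the number of rounds is built into the
   update formulas, so the bound on merging must not depend on the domain. It is the number of
   vertex labels, a label being a parameter or a pair of rank types. Types of single trees suffice
   because a tree sees the rest of the old graph only through one colour per vertex: whether it is
   adjacent to the untouched elements, which holds for all of them or for none. Parameters are
   touched before the change is applied, which keeps the untouched elements indistinguishable
   afterwards. *)
Require Import Defs.
From Stdlib Require List.
From mathcomp Require Import all_boot.
From mathcomp Require Import all_fingroup.
From Stdlib Require Import FunctionalExtensionality.
Set Implicit Arguments. Unset Strict Implicit. Unset Printing Implicit Defensive.

(** * Formulas in two logics *)

(* All constructions are written once over this interface: read in [bool_logic]
   they are the mathematical operations, read in [fo_logic] they are the
   formulas defining them. *)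
Record logic := Logic {
  var : Type;
  form : Type;
  And : form -> form -> form;
  Or : form -> form -> form;
  Not : form -> form;
  Eq : var -> var -> form;
  Ex : (var -> form) -> form
}.

Section Constructions.
Variable L : logic.
Local Notation V := (var L).
Local Notation F := (form L).

Definition All (P : V -> F) : F := Not (Ex (fun x => Not (P x))).
Definition Imp (p q : F) : F := Or (Not p) q.
Definition Iff (p q : F) : F := Or (And p q) (And (Not p) (Not q)).

(* [le] orders the touched elements (x is touched iff [le x x]), [cn] is
   connectedness in the forest, and [sd a b x] says that ab is a forest edge
   and x is in the tree of a once ab is removed. *)
Record struct := Struct {
  le : V -> V -> F;
  cn : V -> V -> F;
  sd : V -> V -> V -> F
}.

Definition dom st x := le st x x.
Definition forest st x y := sd st x y x.
Definition restrict (E : V -> V -> F) st x y := And (dom st x) (And (dom st y) (E x y)).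
Definition same_edge (a b c d : V) : F :=
  Or (And (Eq a c) (Eq b d)) (And (Eq a d) (Eq b c)).
Definition del (E : V -> V -> F) a b x y := And (E x y) (Not (same_edge x y a b)).

(** If [ab] is not a forest edge, [sd st a b] is empty and the equivalence is trivially true, so
    cutting a non-edge changes nothing. *)
Definition cut_cn st a b x y := And (cn st x y) (Iff (sd st a b x) (sd st a b y)).
(** Paths in a forest are unique: if [c] reaches [x] without [cd] and also without [ab], one path
    avoids both edges. Hence the new sides are conjunctions of old relations. *)
Definition cut a b st :=
  Struct (le st) (cut_cn st a b)
    (fun c d x => And (sd st c d x)
       (And (Not (same_edge c d a b)) (cut_cn st a b c x))).

(* [A] links trees outside the root set [Rt] to trees inside it, and [anchor]
   relates x to the endpoint in [Rt] through which its tree is linked. *)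
Definition anchor (C A : V -> V -> F) (Rt : V -> F) x r :=
  Or (And (Eq x r) (Rt r)) (Ex (fun b => And (A b r) (C x b))).
(** A path between different old trees can be taken to climb at most one link into [Rt], move inside
    one root tree, and descend at most one link. *)
Definition attach_cn (C A : V -> V -> F) (Rt : V -> F) x y :=
  Or (C x y) (Ex (fun r => Ex (fun s =>
    And (anchor C A Rt x r) (And (anchor C A Rt y s) (C r s))))).
Definition attach A Rt st :=
  Struct (le st) (attach_cn (cn st) A Rt)
    (fun c d x => And (Or (forest st c d) (Or (A c d) (A d c)))
       (attach_cn (cut_cn st c d) (del A c d) Rt c x)).

(** The lexicographically least candidate [(b, r)] leaving the tree of [b]: a definable choice of
    one link per tree. *)
Definition min_link (N : V -> V -> F) (Rt : V -> F) st b r :=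
  And (Not (Rt b)) (And (Rt r) (And (N b r)
    (All (fun b' => All (fun r' =>
       Imp (And (cn st b b') (And (Rt r') (N b' r')))
           (And (le st b b') (Imp (Eq b b') (le st r r')))))))).
Definition attach_min N Rt st := attach (min_link N Rt st) Rt st.

Definition touch_le st p x y :=
  Or (le st x y)
     (And (Not (dom st p)) (And (Eq y p) (Or (dom st x) (Eq x p)))).
(** A new [p] is a one-vertex tree, and each tree with a neighbour of [p] is hung onto it. If [p]
    was touched before, the root set is empty and nothing is linked. *)
Definition touch E p st :=
  attach_min (fun b r => And (dom st b) (E b r))
    (fun x => And (Eq x p) (Not (dom st p)))
    (Struct (touch_le st p) (cn st) (sd st)).

(** The formula grows with [i]; reachability becomes definable this way only for a bound independent
    of the domain. *)
Fixpoint bridged (C N : V -> V -> F) i x y : F :=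
  if i is j.+1 then
    Or (bridged C N j x y)
       (Ex (fun v => Ex (fun u => And (bridged C N j x v) (And (N v u) (C u y)))))
  else C x y.

(** With [M] large enough for [bounded_by], [M] bridges exhaust the new component and [root] singles
    out its least vertex. *)
Definition root M N st r :=
  And (dom st r) (All (fun y => Imp (bridged (cn st) N M r y) (le st r y))).
Definition level M N st i x :=
  Ex (fun r => And (root M N st r) (bridged (cn st) N i r x)).
(** Levels refer to the structure before the insertion, while links are made in the current one; the
    two agree on trees not yet reached. *)
Fixpoint rounds M N st i :=
  if i is j.+1 then attach_min N (level M N st j) (rounds M N st j) else st.
Definition insert M E' st := rounds M (restrict E' st) st M.

(** The root set is the side of [b], or empty if [ab] was not a forest edge. Edges of the remaining
    graph enter that side only from the side of [a], so at most one replacement link arises. *)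
Definition delete a b E' st :=
  attach_min (restrict E' st)
    (fun x => And (forest st a b) (cut_cn st a b b x)) (cut a b st).

(* All untouched elements have the same neighbours among the touched ones, so
   one edge between the two kinds connects every untouched element. *)
Definition borders (E : V -> V -> F) st x :=
  Ex (fun t => Ex (fun u =>
    And (dom st t) (And (Not (dom st u)) (And (E t u)
      (Or (cn st x t) (Not (dom st x))))))).
(** Untouched elements are pairwise adjacent or pairwise non-adjacent, so without touched neighbours
    a single edge decides their connectedness. *)
Definition connected E st x y :=
  Or (cn st x y) (Or (E x y) (And (borders E st x) (borders E st y))).

End Constructions.

Definition bool_logic (D : finType) : logic :=
  @Logic D bool andb orb negb (fun x y => x == y) (fun P => [exists x, P x]).

(* A formula is abstracted over the size of its environment and names its
   variables by de Bruijn levels, so that variables need no shifting under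
   quantifiers. *)
Definition fo_logic (S : Type) : logic :=
  @Logic nat (nat -> fo S)
    (fun f g n => FAnd (f n) (g n)) (fun f g n => FOr (f n) (g n))
    (fun f n => FNot (f n)) (fun i j n => FEq (n - i.+1) (n - j.+1))
    (fun P n => FEx (P n n.+1)).

(** * Agreement of the formula reading with the operation reading *)

Section Represent.
Variables (S : Type) (D : finType) (I : S -> seq D -> bool).
Implicit Types (w : seq D).

(** [w] lists the environment outermost first, so levels keep their meaning when a quantifier
    extends it at the end; [eval] expects the innermost first, hence the [rev] in [rep0]. *)
Definition repv w (l : nat) (x : D) := onth w l = Some x.
Definition rep0 w (f : nat -> fo S) (b : bool) := eval I (rev w) (f (size w)) = b.
(* Arguments may live in an extension of the environment [w], since relations are
   used under quantifiers. *)
Definition rep1 w (f : nat -> nat -> fo S) (R : pred D) :=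
  forall w' l x, prefix w w' -> repv w' l x -> rep0 w' (f l) (R x).
Definition rep2 w (f : nat -> nat -> nat -> fo S) (R : rel D) :=
  forall w' l x m y, prefix w w' -> repv w' l x -> repv w' m y ->
  rep0 w' (f l m) (R x y).
Definition rep3 w (f : nat -> nat -> nat -> nat -> fo S) (R : D -> rel D) :=
  forall w' l x m y n z, prefix w w' -> repv w' l x -> repv w' m y ->
  repv w' n z -> rep0 w' (f l m n) (R x y z).

Lemma repv_prefix w w' l x : prefix w w' -> repv w l x -> repv w' l x.
Proof.
move=> /prefixP[s ->]; rewrite /repv => h; rewrite onth_cat.
by have := onthTE w l; rewrite h /= => /esym ->.
Qed.

Lemma onth_rev_level w l : l < size w -> onth (rev w) (size w - l.+1) = onth w l.
Proof.
case: w => // d w' lw; set w := d :: w'.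
have e (s : seq D) i : i < size s -> onth s i = Some (nth d s i).
  by move=> h; rewrite onthE (nth_map d).
have lt : size w - l.+1 < size w by rewrite ltn_subrL.
rewrite !e ?size_rev // nth_rev //; congr (Some (nth d _ _)).
by rewrite subnSK // subKn // ltnW.
Qed.

Lemma repv_rev w l x : repv w l x -> onth (rev w) (size w - l.+1) = Some x.
Proof.
move=> h; rewrite onth_rev_level //.
by have := onthTE w l; rewrite h.
Qed.

Lemma rep_And w f g b c : rep0 w f b -> rep0 w g c ->
  rep0 w (@And (fo_logic S) f g) (@And (bool_logic D) b c).
Proof. by rewrite /rep0 /= => -> ->. Qed.

Lemma rep_Or w f g b c : rep0 w f b -> rep0 w g c ->
  rep0 w (@Or (fo_logic S) f g) (@Or (bool_logic D) b c).
Proof. by rewrite /rep0 /= => -> ->. Qed.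

Lemma rep_Not w f b : rep0 w f b ->
  rep0 w (@Not (fo_logic S) f) (@Not (bool_logic D) b).
Proof. by rewrite /rep0 /= => ->. Qed.

Lemma rep_Eq w l x m y : repv w l x -> repv w m y ->
  rep0 w (@Eq (fo_logic S) l m) (@Eq (bool_logic D) x y).
Proof. by move=> hl hm; rewrite /rep0 /= (repv_rev hl) (repv_rev hm). Qed.

Lemma rep_Ex w f P :
  (forall w' l x, prefix w w' -> repv w' l x -> rep0 w' (f l) (P x)) ->
  rep0 w (@Ex (fo_logic S) f) (@Ex (bool_logic D) P).
Proof.
move=> h; rewrite /rep0 /=; apply: eq_existsb => x.
have := h (rcons w x) (size w) x; rewrite /rep0 rev_rcons size_rcons; apply.
  by rewrite -cats1 prefix_prefix.
by rewrite /repv -cats1 onth_cat ltnn subnn.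
Qed.

Definition rep_struct w (st : struct (fo_logic S)) (st' : struct (bool_logic D)) :=
  [/\ rep2 w (le st) (le st'), rep2 w (cn st) (cn st') & rep3 w (sd st) (sd st')].

End Represent.

Ltac prefix_tac :=
  first [assumption | exact: prefix_refl
        | match goal with Hpre : is_true (prefix ?w ?w1) |- is_true (prefix ?w _) =>
            apply (prefix_trans Hpre); prefix_tac end].

Ltac repv_tac :=
  first [assumption
        | match goal with Hv : repv ?w1 ?l ?x |- repv ?w ?l ?x =>
            apply (fun p => repv_prefix p Hv); prefix_tac end].

(** Both readings instantiate the same term over [logic], so agreement is proved by descending
    through the two terms in parallel, with the hypotheses on relations used at the leaves. *)
Ltac rep_tac :=
  lazymatch goal with
  | |- rep1 _ _ _ _ => intros ? ? ? ? ?; cbv beta; rep_tac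
  | |- rep2 _ _ _ _ => intros ? ? ? ? ? ? ? ?; cbv beta; rep_tac
  | |- rep3 _ _ _ _ => intros ? ? ? ? ? ? ? ? ? ? ?; cbv beta; rep_tac
  | |- rep0 _ _ (And _ _) (And _ _) => apply: rep_And; rep_tac
  | |- rep0 _ _ (Or _ _) (Or _ _) => apply: rep_Or; rep_tac
  | |- rep0 _ _ (Not _) (Not _) => apply: rep_Not; rep_tac
  | |- rep0 _ _ (Eq _ _) (Eq _ _) => apply: rep_Eq; repv_tac
  | |- rep0 _ _ (Ex _) (Ex _) => apply: rep_Ex => ? ? ? ? ?; rep_tac
  | |- rep0 _ _ _ _ =>
      first [match goal with
             | Hrep : rep1 _ ?w ?f ?R |- rep0 _ _ (?f _) (?R _) => eapply Hrep; rep_leaf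
             | Hrep : rep2 _ ?w ?f ?R |- rep0 _ _ (?f _ _) (?R _ _) => eapply Hrep; rep_leaf
             | Hrep : rep3 _ ?w ?f ?R |- rep0 _ _ (?f _ _ _) (?R _ _ _) => eapply Hrep; rep_leaf
             end | idtac]
  | |- _ => idtac
  end
with rep_leaf := first [repv_tac | prefix_tac].

Section RepresentConstructions.
Variables (S : Type) (D : finType) (I : S -> seq D -> bool).
Notation Lf := (fo_logic S).
Notation Lb := (bool_logic D).
Notation rep1 := (rep1 I).
Notation rep2 := (rep2 I).
Notation rep3 := (rep3 I).
Notation rep_struct := (rep_struct I).

Lemma rep_restrict w (E : nat -> nat -> nat -> fo S) (E' : rel D) st st' :
  rep2 w E E' -> rep_struct w st st' ->
  rep2 w (restrict (L := Lf) E st) (restrict (L := Lb) E' st').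
Proof. move=> hE [hl hc hs]; rewrite /restrict /dom; rep_tac. Qed.

Lemma rep_attach w (A : nat -> nat -> nat -> fo S) (A' : rel D)
    (R : nat -> nat -> fo S) (R' : pred D) st st' :
  rep2 w A A' -> rep1 w R R' -> rep_struct w st st' ->
  rep_struct w (attach (L := Lf) A R st) (attach (L := Lb) A' R' st').
Proof.
move=> hA hR [hl hc hs]; split; cbn [attach le cn sd];
  rewrite /attach_cn /anchor /cut_cn /del
  /same_edge /forest /Iff; rep_tac.
Qed.

Lemma rep_attach_min w (A : nat -> nat -> nat -> fo S) (A' : rel D)
    (R : nat -> nat -> fo S) (R' : pred D) st st' :
  rep2 w A A' -> rep1 w R R' -> rep_struct w st st' ->
  rep_struct w (attach_min (L := Lf) A R st) (attach_min (L := Lb) A' R' st').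
Proof.
move=> hA hR hst; apply: rep_attach => //; case: hst => hl hc hs.
rewrite /min_link /All /Imp; rep_tac.
Qed.

Lemma rep_cut w a a' b b' st st' :
  repv w a a' -> repv w b b' -> rep_struct w st st' ->
  rep_struct w (cut (L := Lf) a b st) (cut (L := Lb) a' b' st').
Proof.
move=> ha hb [hl hc hs]; split; cbn [cut le cn sd]; rewrite /cut_cn /same_edge /Iff; rep_tac.
Qed.

Lemma rep_touch w (E : nat -> nat -> nat -> fo S) (E' : rel D) p p' st st' :
  rep2 w E E' -> repv w p p' -> rep_struct w st st' ->
  rep_struct w (touch (L := Lf) E p st) (touch (L := Lb) E' p' st').
Proof.
move=> hE hp [hl hc hs]; apply: rep_attach_min; rewrite /dom; try rep_tac.
split; cbn [cut le cn sd]; rewrite /touch_le /dom; rep_tac.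
Qed.

Lemma rep_bridged w (C N : nat -> nat -> nat -> fo S) (C' N' : rel D) i :
  rep2 w C C' -> rep2 w N N' ->
  rep2 w (bridged (L := Lf) C N i) (bridged (L := Lb) C' N' i).
Proof. move=> hC hN; elim: i => [|i IH] //; cbn [bridged]; rep_tac. Qed.

Lemma rep_root w M (N : nat -> nat -> nat -> fo S) (N' : rel D) st st' :
  rep2 w N N' -> rep_struct w st st' ->
  rep1 w (root (L := Lf) M N st) (root (L := Lb) M N' st').
Proof.
move=> hN [hl hc hs]; have hB := rep_bridged M hc hN.
rewrite /root /dom /All /Imp; rep_tac.
Qed.

Lemma rep_level w M (N : nat -> nat -> nat -> fo S) (N' : rel D) i st st' :
  rep2 w N N' -> rep_struct w st st' ->
  rep1 w (level (L := Lf) M N st i) (level (L := Lb) M N' st' i).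
Proof.
move=> hN hst; have hR := rep_root M hN hst; case: hst => [hl hc hs].
have hB := rep_bridged i hc hN.
rewrite /level; rep_tac.
Qed.

Lemma rep_insert w M (E : nat -> nat -> nat -> fo S) (E' : rel D) st st' :
  rep2 w E E' -> rep_struct w st st' ->
  rep_struct w (insert (L := Lf) M E st) (insert (L := Lb) M E' st').
Proof.
move=> hE hst; rewrite /insert; have hN := rep_restrict hE hst.
elim: {2 4}M => [|i IH] //; cbn [rounds].
by apply: rep_attach_min => //; exact: rep_level.
Qed.

Lemma rep_delete w a a' b b' (E : nat -> nat -> nat -> fo S) (E' : rel D) st st' :
  repv w a a' -> repv w b b' -> rep2 w E E' -> rep_struct w st st' ->
  rep_struct w (delete (L := Lf) a b E st) (delete (L := Lb) a' b' E' st').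
Proof.
move=> ha hb hE hst; apply: rep_attach_min; [exact: rep_restrict| |exact: rep_cut].
by case: hst => hl hc hs; rewrite /forest /cut_cn /Iff; rep_tac.
Qed.

Lemma rep_connected w (E : nat -> nat -> nat -> fo S) (E' : rel D) st st' :
  rep2 w E E' -> rep_struct w st st' ->
  rep2 w (connected (L := Lf) E st) (connected (L := Lb) E' st').
Proof.
move=> hE [hl hc hs]; rewrite /connected /borders /dom; rep_tac.
Qed.

End RepresentConstructions.

(** * Spanning forests *)

Arguments same_edge : simpl never.
Arguments del : simpl never.
Arguments anchor : simpl never.
Arguments cut_cn : simpl never.
Arguments attach_cn : simpl never.
Arguments min_link : simpl never.
Arguments forest : simpl never.
Arguments dom : simpl never.
Arguments root : simpl never.
Arguments level : simpl never.
Arguments restrict : simpl never.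

Section Forests.
Variable D : finType.
Notation Lb := (bool_logic D).
Implicit Types (G A N E : rel D) (Rt : pred D) (st : struct Lb).

Lemma connect_rind G (P : D -> D -> Prop) :
  (forall x, P x x) -> (forall x y z, P x y -> G y z -> P x z) ->
  forall x y, connect G x y -> P x y.
Proof.
move=> h0 hS x y /connectP[p].
elim/last_ind: p y => [|p z IH] y /=; first by move=> _ ->.
rewrite rcons_path last_rcons => /andP[pth e] ->.
exact: hS (IH _ pth erefl) e.
Qed.

Lemma same_edgeP (a b c d : D) :
  reflect (a = c /\ b = d \/ a = d /\ b = c) (same_edge (L := Lb) a b c d).
Proof.
rewrite /same_edge /=; apply: (iffP orP).
  by case=> /andP[/eqP-> /eqP->]; [left|right].
by case=> -[-> ->]; rewrite !eqxx; [left|right].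
Qed.

Lemma same_edgeC (a b c d : D) :
  same_edge (L := Lb) a b c d = same_edge (L := Lb) b a c d.
Proof. by rewrite /same_edge /= orbC; congr (_ || _); rewrite andbC. Qed.

Lemma same_edgeCr (a b c d : D) :
  same_edge (L := Lb) a b c d = same_edge (L := Lb) a b d c.
Proof. by rewrite /same_edge /= orbC. Qed.

Definition delb G a b : rel D := del (L := Lb) G a b.

Lemma delb_sym G a b : symmetric G -> symmetric (delb G a b).
Proof. by move=> h x y; rewrite /delb /del /= h same_edgeC. Qed.

Lemma delbC G a b : delb G a b =2 delb G b a.
Proof. by move=> x y; rewrite /delb /del same_edgeCr. Qed.

Lemma delb_sub G a b : subrel (delb G a b) G.
Proof. by move=> x y /andP[]. Qed.

Lemma connect_mono G G' : subrel G G' -> subrel (connect G) (connect G').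
Proof. by move=> h; apply: connect_sub => x y /h; apply: connect1. Qed.

Lemma delb_id G a b : symmetric G -> ~~ G a b -> delb G a b =2 G.
Proof.
move=> sG nab x y; rewrite /delb /del /=; case: (boolP (G x y)) => // gxy /=.
apply/negP => /same_edgeP[] [ex ey]; rewrite ex ey ?(sG b a) in gxy;
  by rewrite gxy in nab.
Qed.

(** A path can be shortened until it uses [ab] at most once, in one of two directions. *)
Lemma connect_del_split G a b x y : connect G x y ->
  [\/ connect (delb G a b) x y,
      connect (delb G a b) x a /\ connect (delb G a b) b y |
      connect (delb G a b) x b /\ connect (delb G a b) a y].
Proof.
move: x y; apply: connect_rind => [x|x y z IH gyz].
  by apply: Or31.
have [/same_edgeP[] [ey ez]|ns] := boolP (same_edge (L := Lb) y z a b).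
- rewrite {}ey in IH; rewrite {}ez.
  by case: IH => [h|[h _]|[h _]]; [apply: Or32|apply: Or32|apply: Or31].
- rewrite {}ey in IH; rewrite {}ez.
  by case: IH => [h|[h _]|[h _]]; [apply: Or33|apply: Or31|apply: Or33].
have e : delb G a b y z by rewrite /delb /del /= gyz.
have c u : connect (delb G a b) u y -> connect (delb G a b) u z.
  by move=> h; apply: connect_trans h (connect1 e).
by case: IH => [/c h|[h /c h']|[h /c h']];
  [apply: Or31|apply: Or32|apply: Or33].
Qed.

Definition forestb st : rel D := forest (L := Lb) st.

(** Acyclicity is expressed by each edge being the only connection between its ends, a form about
    [delb] that fits the meaning of [sd]. *)
Record spanning st : Prop := Spanning {
  spn_sym : symmetric (forestb st);
  spn_cn : forall x y, cn st x y = connect (forestb st) x y;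
  spn_sd : forall a b x,
    sd st a b x = forestb st a b && connect (delb (forestb st) a b) a x;
  spn_acyc : forall a b, forestb st a b -> ~~ connect (delb (forestb st) a b) a b
}.

(** A path that is lost must cross [ab], and then by acyclicity exactly one of its ends is on the
    side of [a]. *)
Lemma cut_cnE st a b : spanning st ->
  cut_cn (L := Lb) st a b =2 connect (delb (forestb st) a b).
Proof.
case=> sF hc hs ac x y; rewrite /cut_cn /Iff /= hc !hs.
case: (boolP (forestb st a b)) => [fab|nab] /=; last first.
  by rewrite andbT (eq_connect (delb_id sF nab)).
have cs := sym_connect_sym (delb_sym a b sF).
have sub := connect_mono (@delb_sub (forestb st) a b).
apply/idP/idP => [/andP[cxy h]|h].
  case: (connect_del_split a b cxy) => // -[h1 h2].
    move: h; rewrite (cs a x) h1 /= orbF => h.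
    by have := ac _ _ fab; rewrite (connect_trans h) // cs.
  move: h; rewrite h2 andbT => /orP[h|/andP[_]//].
  by have := ac _ _ fab; rewrite (connect_trans h) // cs.
rewrite (sub _ _ h) /=.
have -> : connect (delb (forestb st) a b) a x = connect (delb (forestb st) a b) a y.
  by rewrite !(cs a); apply: same_connect.
by case: connect.
Qed.

Lemma forest_cut st a b : spanning st ->
  forestb (cut (L := Lb) a b st) =2 delb (forestb st) a b.
Proof.
move=> ok c d; rewrite /forestb /forest /= cut_cnE // connect0 andbT.
by rewrite spn_sd // connect0 andbT.
Qed.

Lemma eq_delb G G' a b : G =2 G' -> delb G a b =2 delb G' a b.
Proof. by move=> h x y; rewrite /delb /del /= h. Qed.

Lemma spanning_cut st a b : spanning st -> spanning (cut (L := Lb) a b st).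
Proof.
move=> ok; have [sF hc hs ac] := ok; have fc := forest_cut a b ok.
set F := forestb st in sF hc hs ac fc *.
have subd c d : subrel (delb (delb F a b) c d) (delb F c d).
  by move=> x y; rewrite /delb /del /= -andbA andbCA => /andP[].
split.
- by move=> x y; rewrite !fc delb_sym.
- by move=> x y; rewrite /= cut_cnE // (eq_connect fc).
- move=> c d x; rewrite fc (eq_connect (eq_delb _ _ fc)) /=.
  rewrite cut_cnE // hs -/F (_ : delb F a b c d = F c d && ~~ same_edge (L := Lb) c d a b) //.
  case: (boolP (F c d)) => //= fcd.
  have [_|_] /= := boolP (same_edge (L := Lb) c d a b); first by rewrite andbF.
  have sab := delb_sym a b sF; have scd := delb_sym c d sF.
  apply/andP/idP => [[h1 h2]|h]; last first.
    by split; apply: connect_mono h => //; apply: delb_sub.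
  have e : delb (delb F c d) a b =2 delb (delb F a b) c d.
    by move=> u v; rewrite /delb /del /= -!andbA; congr (_ && _); rewrite andbC.
  have sub : subrel (delb (delb F c d) a b) (delb F a b).
    by move=> u v; rewrite e => /delb_sub.
  have cs := sym_connect_sym sab.
  have [fab|nab] := boolP (F a b); last first.
    rewrite -(eq_connect e) (eq_connect (delb_id scd _)) //.
    by apply: contra nab => /delb_sub.
  rewrite -(eq_connect e).
  (* If the path avoiding [cd] crosses [ab], then together with [h2], a path avoiding [ab], it joins
     [a] to [b] without [ab]. *)
  case: (connect_del_split a b h1) => // -[/(connect_mono sub) k1 /(connect_mono sub) k2];
    case/negP: (ac _ _ fab).
    by rewrite (connect_trans _ (connect_trans h2 _)) // cs.
  by rewrite (connect_trans k2 _) // cs (connect_trans _ h2) // cs.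
- move=> c d; rewrite fc (eq_connect (eq_delb _ _ fc)) => /delb_sub /ac.
  by apply: contra; apply: connect_mono; apply: subd.
Qed.

Definition linked G A : rel D := fun x y => G x y || (A x y || A y x).

Lemma anchorP (C A : rel D) Rt x r :
  reflect (x = r /\ Rt r \/ exists2 b, A b r & C x b)
    (anchor (L := Lb) C A Rt x r).
Proof.
apply: (iffP orP).
  case=> [/andP[/eqP-> h]|/existsP[b /andP[h1 h2]]]; first by left.
  by right; exists b.
case=> [[-> h]|[b h1 h2]]; first by left; rewrite /= eqxx.
by right; apply/existsP; exists b; rewrite /= h1.
Qed.

Lemma attach_cnP (C A : rel D) Rt x y :
  reflect (C x y \/ exists r s, [/\ anchor (L := Lb) C A Rt x r,
      anchor (L := Lb) C A Rt y s & C r s])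
    (attach_cn (L := Lb) C A Rt x y).
Proof.
apply: (iffP orP) => -[h|]; try by left.
  by move=> /existsP[r /existsP[s /and3P[h1 h2 h3]]]; right; exists r, s.
move=> [r [s [h1 h2 h3]]]; right; apply/existsP; exists r; apply/existsP; exists s.
exact/and3P.
Qed.

Lemma eq_attach_cn (C C' A : rel D) Rt :
  C =2 C' -> attach_cn (L := Lb) C A Rt =2 attach_cn (L := Lb) C' A Rt.
Proof.
move=> h x y; rewrite /attach_cn /anchor /= h; congr (_ || _).
apply: eq_existsb => r; apply: eq_existsb => s; rewrite h.
by congr [&& _ || _, _ || _ & _]; apply: eq_existsb => b; rewrite h.
Qed.

(** A tree lies in [Rt] or has at most one link, so anchors of connected vertices are connected.
    This makes [attach_cn] stable under appending an edge to a path. *)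
Lemma connect_attach G A Rt :
  symmetric G -> (forall x y, connect G x y -> Rt x -> Rt y) ->
  (forall b r, A b r -> ~~ Rt b /\ Rt r) ->
  (forall b r b' r', A b r -> A b' r' -> connect G b b' -> b = b' /\ r = r') ->
  attach_cn (L := Lb) (connect G) A Rt =2 connect (linked G A).
Proof.
move=> sG hRt hA uA.
have cs := sym_connect_sym sG.
have sL : symmetric (linked G A).
  by move=> x y; rewrite /linked sG; congr (_ || _); rewrite orbC.
have csL := sym_connect_sym sL.
have subG : subrel (connect G) (connect (linked G A)).
  by apply: connect_mono => x y; rewrite /linked => ->.
have anchor_uniq x y r s : connect G x y -> anchor (L := Lb) (connect G) A Rt x r ->
    anchor (L := Lb) (connect G) A Rt y s -> connect G r s.
  move=> cxy /anchorP[[<- Rx]|[b Abr cxb]] /anchorP[[<- Ry]|[b' Abs cyb]] //.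
  - case: (hA _ _ Abs) => /negP[]; exact: hRt (connect_trans cxy cyb) Rx.
  - case: (hA _ _ Abr) => /negP[]; apply: hRt Ry.
    by apply: connect_trans cxb; rewrite cs.
  - have [//|_ ->//] := uA _ _ _ _ Abr Abs.
    by apply: connect_trans (connect_trans cxy cyb); rewrite cs.
have anchor_tr x y s : connect G x y -> anchor (L := Lb) (connect G) A Rt y s ->
    exists2 r, anchor (L := Lb) (connect G) A Rt x r & connect G r s.
  move=> cxy /anchorP[[<- Ry]|[b Abs cyb]].
    by exists x => //; apply/anchorP; left; split=> //; apply: hRt Ry; rewrite cs.
  by exists s => //; apply/anchorP; right; exists b => //; apply: connect_trans cyb.
have anchor_conn x r : anchor (L := Lb) (connect G) A Rt x r -> connect (linked G A) x r.
  case/anchorP => [[->]//|[b Abr /subG cxb]].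
  by apply: connect_trans cxb (connect1 _); rewrite /linked Abr orbT.
move=> x y; apply/idP/idP.
  case/attach_cnP => [/subG//|[r [s [/anchor_conn h1 /anchor_conn h2 /subG h3]]]].
  by apply: connect_trans h1 (connect_trans h3 _); rewrite csL.
move: x y; apply: connect_rind => [x|x y z /attach_cnP h e]; first by apply/attach_cnP; left.
apply/attach_cnP; have hyz : connect G y z \/ exists r s, [/\ anchor (L := Lb) (connect G) A Rt y r,
      anchor (L := Lb) (connect G) A Rt z s & connect G r s].
  case/orP: e => [/connect1|/orP[a|a]]; [by left|right..].
    exists z, z; split=> //; apply/anchorP; last by left; split=> //; case: (hA _ _ a).
    by right; exists y.
  exists y, y; split=> //; apply/anchorP; first by left; split=> //; case: (hA _ _ a).
  by right; exists z.
case: h hyz => [cxy|[r [s [h1 h2 h3]]]] [cyz|[r' [s' [k1 k2 k3]]]].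
- by left; apply: connect_trans cyz.
- have [r h1 h2] := anchor_tr _ _ _ cxy k1.
  by right; exists r, s'; split=> //; apply: connect_trans k3.
- have [s' k1 k2] : exists2 s', anchor (L := Lb) (connect G) A Rt z s' & connect G s' s.
    by apply: anchor_tr h2; rewrite cs.
  by right; exists r, s'; split=> //; apply: connect_trans h3 _; rewrite cs.
- right; exists r, s'; split=> //.
  by apply: connect_trans h3 (connect_trans (anchor_uniq _ _ _ _ (connect0 _ _) h2 k1) k3).
Qed.

Lemma linked_delb G A a b :
  linked (delb G a b) (delb A a b) =2 delb (linked G A) a b.
Proof.
move=> x y; rewrite /linked /delb /del /= (same_edgeC y x).
by rewrite -!andb_orl.
Qed.

(** Linking commutes with deleting an edge, so [connect_attach] also describes the linked forest
    minus [cd]; the sides and acyclicity are read off from that. *)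
Lemma spanning_attach st A Rt : spanning st ->
  (forall x y, cn st x y -> Rt x -> Rt y) ->
  (forall b r, A b r -> ~~ Rt b /\ Rt r) ->
  (forall b r b' r', A b r -> A b' r' -> cn st b b' -> b = b' /\ r = r') ->
  spanning (attach (L := Lb) A Rt st) /\
  forestb (attach (L := Lb) A Rt st) =2 linked (forestb st) A.
Proof.
move=> ok hRt hA uA; have [sF hc hs ac] := ok.
set F := forestb st in sF hc hs ac *.
have cs := sym_connect_sym sF.
have catt c d : attach_cn (L := Lb) (cut_cn (L := Lb) st c d) (del (L := Lb) A c d) Rt
    =2 connect (delb (linked F A) c d).
  move=> x y; rewrite (eq_attach_cn _ _ (cut_cnE c d ok)).
  rewrite -(eq_connect (linked_delb _ _ _ _)).
  have sub := connect_mono (@delb_sub F c d).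
  apply: connect_attach.
  - exact: delb_sym.
  - by move=> u v /sub; rewrite -hc; apply: hRt.
  - by move=> b r /delb_sub; apply: hA.
  - move=> b r b' r' /delb_sub A1 /delb_sub A2 /sub; rewrite -hc; exact: uA.
have fE : forestb (attach (L := Lb) A Rt st) =2 linked F A.
  move=> c d; rewrite /forestb {1}/forest /= catt connect0 andbT.
  by rewrite /linked /F /forestb.
split=> //; split.
- by move=> x y; rewrite !fE /linked sF; congr (_ || _); rewrite orbC.
- move=> x y; rewrite (eq_connect fE) /= (eq_attach_cn _ _ hc).
  apply: connect_attach => // [u v|b r b' r']; rewrite -hc; [exact: hRt|exact: uA].
- move=> a b x; rewrite fE (eq_connect (eq_delb _ _ fE)) /= catt.
  by rewrite /linked /F /forestb.
move=> c d; rewrite fE (eq_connect (eq_delb _ _ fE)) => fcd.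
(* Once its only link is removed, the tree of [c'] has no anchor at all, and it does not contain
   [d'], which lies in [Rt]. *)
have noA c' d' : A c' d' -> ~~ connect (delb (linked F A) c' d') c' d'.
  move=> a; rewrite -catt; have [nRc Rd] := hA _ _ a; apply/attach_cnP.
  have cut_sub u v : cut_cn (L := Lb) st c' d' u v -> cn st u v by case/andP.
  case=> [/cut_sub h|[r [s [/anchorP[[er Rr]|[b ab cb]] _ _]]]].
    by case/negP: nRc; apply: hRt Rd; rewrite hc cs -hc.
    by rewrite er Rr in nRc.
  case/andP: ab => ab ns; have [eb er] := uA _ _ _ _ a ab (cut_sub _ _ cb).
  by case/negP: ns; apply/same_edgeP; rewrite eb er; left.
case/or3P: fcd => [fcd|/noA//|]; last first.
  move/noA; have sL : symmetric (linked F A).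
    by move=> x y; rewrite /linked sF; congr (_ || _); rewrite orbC.
  by rewrite (eq_connect (delbC _ _ _)) (sym_connect_sym (delb_sym _ _ sL)).
have ccd : cn st c d by rewrite hc connect1.
have cdc : cn st d c by rewrite hc cs -hc.
have csd := sym_connect_sym (delb_sym c d sF).
have ncd := ac _ _ fcd.
have sub u v : cut_cn (L := Lb) st c d u v -> cn st u v by case/andP.
(* Both ends of an old edge lie in one old tree. In [Rt] they are their own anchors; otherwise both
   use the single link of that tree, whose lower end [b] would join [c] to [d] inside the cut
   tree. *)
rewrite -catt; apply/attach_cnP; case=> [|[r [s [/anchorP hr /anchorP hs' hrs]]]].
  by rewrite cut_cnE // (negPf ncd).
case: hr => [[er Rr]|[b /andP[ab _] cb]]; case: hs' => [[es Rs]|[b' /andP[ab' _] cb']].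
- by rewrite -er -es cut_cnE // (negPf ncd) in hrs.
- have [/negP[]] := hA _ _ ab'; apply: (hRt c); last by rewrite er.
  by rewrite hc; apply: (@connect_trans _ _ d); rewrite -hc // sub.
- have [/negP[]] := hA _ _ ab; apply: (hRt d); last by rewrite es.
  by rewrite hc; apply: (@connect_trans _ _ c); rewrite -hc // sub.
have cbb : cn st b b'.
  rewrite hc; apply: (@connect_trans _ _ d); last by rewrite -hc sub.
  by apply: (@connect_trans _ _ c); [rewrite cs -hc sub|rewrite -hc].
have [eb _] := uA _ _ _ _ ab ab' cbb; rewrite -eb in cb'.
rewrite !cut_cnE // in cb cb'.
by case/negP: ncd; apply: connect_trans cb _; rewrite csd.
Qed.

End Forests.

(** * Updates of the auxiliary structure *)

Section States.
Variable D : finType.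
Notation Lb := (bool_logic D).
Implicit Types (G A N E : rel D) (Rt : pred D) (st : struct Lb).

Definition domb st : pred D := dom (L := Lb) st.

Record ordered st : Prop := Ordered {
  ord_dom : forall x y, le st x y -> domb st x /\ domb st y;
  ord_anti : forall x y, le st x y -> le st y x -> x = y;
  ord_trans : forall x y z, le st x y -> le st y z -> le st x z;
  ord_total : forall x y, domb st x -> domb st y -> le st x y \/ le st y x
}.

(** Take an element of [P] with fewest predecessors. Any [y] of [P] below it has the same set of
    predecessors, hence also lies above it. *)
Lemma ordered_min st (P : pred D) x : ordered st ->
  (forall y, P y -> domb st y) -> P x -> exists2 m, P m & forall y, P y -> le st m y.
Proof.
move=> [hd ha ht hl] hP Px.
pose f m := #|[set y | (le st y m : bool)]|.
case: (arg_minnP f Px) => m Pm hm; exists m => // y Py.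
have [//|lym] := hl _ _ (hP _ Pm) (hP _ Py).
suff -> : m = y by apply: hP.
apply: ha => //; have /subset_leqif_cards[_] : [set z | (le st z y : bool)] \subset [set z | (le st z m : bool)].
  by apply/subsetP => z; rewrite !inE => h; apply: ht lym.
rewrite eqn_leq (hm _ Py) subset_leq_card; last first.
  by apply/subsetP => z; rewrite !inE => h; apply: ht lym.
move=> /esym/eqP/setP/(_ m); rewrite !inE => ->; exact: hP.
Qed.

Lemma min_linkP N Rt st b r :
  reflect [/\ ~~ Rt b, Rt r, N b r & forall b' r', cn st b b' -> Rt r' -> N b' r' ->
      le st b b' /\ (b = b' -> le st r r')]
    (min_link (L := Lb) N Rt st b r).
Proof.
rewrite /min_link /All /Imp /=; apply: (iffP and4P) => -[h1 h2 h3 h]; split=> //.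
  move=> b' r' c1 c2 c3; move: h => /existsPn/(_ b'); rewrite negbK => /existsPn/(_ r').
  rewrite negbK c1 c2 c3 /= => /andP[-> h]; split=> // e.
  by move: h; rewrite e eqxx.
apply/existsPn => b'; rewrite negbK; apply/existsPn => r'; rewrite negbK.
case: (boolP (_ && _)) => //= /and3P[c1 c2 c3]; have [-> h'] := h _ _ c1 c2 c3.
by case: eqP => //= e; apply: h'.
Qed.

(** The interface to one round of linking. Candidates have touched ends, so a least one exists and
    every tree with a candidate does obtain an anchor. *)
Lemma attach_min_spec N Rt st : spanning st -> ordered st ->
  (forall x y, cn st x y -> Rt x -> Rt y) ->
  (forall b r, Rt r -> N b r -> domb st b /\ domb st r) ->
  let U := anchor (L := Lb) (cn st) (min_link (L := Lb) N Rt st) Rt in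
  let st' := attach_min (L := Lb) N Rt st in
  [/\ spanning st',
      (forall x y, forestb st' x y -> [\/ forestb st x y, Rt y && N x y | Rt x && N y x]) /\
      forall x y, cn st' x y <->
        cn st x y \/ exists r s, [/\ U x r, U y s & cn st r s],
      forall x, Rt x -> U x x,
      forall x b r, ~~ Rt x -> cn st x b -> Rt r -> N b r -> exists r', U x r' &
      forall x r, U x r -> Rt r /\ (x = r \/ exists b, [/\ ~~ Rt b, N b r & cn st x b])].
Proof.
move=> ok oo hRt hN U st'; have [sF hc _ _] := ok; have cs := sym_connect_sym sF.
have [|b r b' r'|sp' fE] := @spanning_attach _ st (min_link (L := Lb) N Rt st) Rt ok hRt.
- by move=> b r /min_linkP[].
- move=> /min_linkP[nb Rr Nbr h] /min_linkP[nb' Rr' Nbr' h'] c.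
  have c' : cn st b' b by rewrite hc cs -hc.
  have [l1 k1] := h _ _ c Rr' Nbr'; have [l2 k2] := h' _ _ c' Rr Nbr.
  have e := ord_anti oo l1 l2; split=> //.
  by apply: (ord_anti oo); [apply: k1|apply: k2].
split.
- exact: sp'.
- split=> x y; last exact: (iff_sym (rwP (attach_cnP _ _ _ _ _))).
  rewrite fE => /or3P[?|/min_linkP[_ h1 h2 _]|/min_linkP[_ h1 h2 _]].
  + by apply: Or31.
  + by apply: Or32; rewrite h1.
  + by apply: Or33; rewrite h1.
- by move=> x Rx; apply/anchorP; left.
- move=> x b r nRx cxb Rr Nbr.
  pose P := [pred b | cn st x b & [exists r, Rt r && N b r]].
  have Pb : P b by rewrite inE cxb; apply/existsP; exists r; rewrite Rr.
  have [|m /andP[cxm /existsP[s /andP[Rs Nms]]] hm] := ordered_min oo _ Pb.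
    by move=> y /andP[_ /existsP[s /andP[Rs /(hN _ _ Rs)[]]]].
  pose Q := [pred s | Rt s && N m s].
  have Qs : Q s by rewrite /= Rs.
  have [|t /andP[Rt' Nt] ht] := ordered_min oo _ Qs.
    by move=> y /andP[Ry /(hN _ _ Ry)[]].
  exists t; apply/anchorP; right; exists m => //; apply/min_linkP; split=> //.
    by apply: contra nRx; apply: hRt; rewrite hc cs -hc.
  move=> b' r' c1 c2 c3; split.
    apply: hm; apply/andP; split; last by apply/existsP; exists r'; rewrite c2.
    by move: cxm c1; rewrite !hc; apply: connect_trans.
  by move=> e; apply: ht; rewrite /= c2 e.
- move=> x r /anchorP[[-> Rr]|[b /min_linkP[nb Rr Nbr _] cxb]]; first by split; [|left].
  by split=> //; right; exists b.
Qed.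

Definition restrictb E st : rel D := restrict (L := Lb) E st.

(** The forest describes only the graph induced on the touched elements; [good_hom] controls the
    rest, every transposition of untouched elements being an automorphism of the whole graph. *)
Record good E st : Prop := Good {
  good_ord : ordered st;
  good_spn : spanning st;
  good_cn : forall x y, cn st x y = connect (restrictb E st) x y;
  good_sub : subrel (forestb st) (restrictb E st);
  good_hom : forall u v, ~~ domb st u -> ~~ domb st v ->
    forall x y, E (tperm u v x) (tperm u v y) = E x y
}.

Lemma restrictbP E st x y :
  reflect [/\ domb st x, domb st y & E x y] (restrictb E st x y).
Proof. exact: and3P. Qed.

Lemma restrict_sym E st : symmetric E -> symmetric (restrictb E st).
Proof. by move=> sE x y; rewrite /restrictb /restrict /= sE andbCA. Qed.

Lemma touch_leP st p x y :
  reflect (le st x y \/ [/\ ~~ domb st p, y = p & domb st x \/ x = p])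
    (touch_le (L := Lb) st p x y).
Proof.
apply: (iffP orP) => -[h|h]; try (by left); right.
  by case/and3P: h => h1 /eqP-> /orP[h2|/eqP->]; split=> //; [left|right].
case: h => h1 -> h; apply/and3P; split=> //=.
by apply/orP; case: h => [h|->]; [left|right; rewrite eqxx].
Qed.

Definition touch_st p st : struct Lb := Struct (touch_le (L := Lb) st p) (cn st) (sd st).

Lemma domb_touch p st x : domb (touch_st p st) x = domb st x || (x == p).
Proof.
apply/touch_leP/orP => [[h|[_ -> _]]|[h|/eqP->]]; [by left|by right|by left|].
by have [h|h] := boolP (domb st p); [left|right; split=> //; right].
Qed.

Lemma ordered_touch p st : ordered st -> ordered (touch_st p st).
Proof.
case=> hd ha ht hl.
have np x y : ~~ domb st p -> le st x y -> x <> p /\ y <> p.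
  by move=> np /hd[d1 d2]; split=> e; rewrite e in d1 d2; rewrite ?d1 ?d2 in np.
split.
- move=> x y /touch_leP[/hd[d1 d2]|[h -> h']]; rewrite !domb_touch.
    by rewrite d1 d2.
  by rewrite eqxx orbT; split=> //; case: h' => [->//|->]; rewrite eqxx orbT.
- move=> x y /touch_leP[h1|[h -> h']] /touch_leP[h2|[k e k']] //.
  + exact: ha.
  + by have [] := np _ _ k h1; rewrite e.
  + by have [] := np _ _ h h2.
- move=> x y z /touch_leP[h1|[h ey h']] /touch_leP[h2|[k e k']] //; apply/touch_leP.
  + by left; apply: ht h2.
  + by right; split=> //; left; case: (hd _ _ h1).
  + by have [] := np _ _ h h2; rewrite ey.
  + by right.
- move=> x y; rewrite !domb_touch => /orP[dx|/eqP->] /orP[dy|/eqP->].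
  + by case: (hl _ _ dx dy) => h; [left|right]; apply/touch_leP; left.
  + have [dp|dp] := boolP (domb st p); last by left; apply/touch_leP; right; split=> //; left.
    by case: (hl _ _ dx dp) => h; [left|right]; apply/touch_leP; left.
  + have [dp|dp] := boolP (domb st p); last by right; apply/touch_leP; right; split=> //; left.
    by case: (hl _ _ dy dp) => h; [right|left]; apply/touch_leP; left.
  + left; apply/touch_leP; have [dp|dp] := boolP (domb st p); first by left.
    by right; split=> //; right.
Qed.

Lemma touch_good E p st : symmetric E -> good E st ->
  [/\ good E (touch (L := Lb) E p st), domb (touch (L := Lb) E p st) p &
      forall x, domb st x -> domb (touch (L := Lb) E p st) x].
Proof.
move=> sE [oo ok hc hs hh].
have dE : domb (touch (L := Lb) E p st) =1 fun x => domb st x || (x == p).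
  by move=> x; rewrite -domb_touch.
split; [|by rewrite dE eqxx orbT|by move=> x; rewrite dE => ->].
have ok1 : spanning (touch_st p st) by case: ok.
have oo1 := ordered_touch p oo.
have fdom x y : connect (restrictb E st) x y -> x = y \/ domb st y.
  move: x y; apply: connect_rind => [x|x y z _ /and3P[_ ? _]]; by [left|right].
have [||sp [fE cE] U0 U1 U2] := @attach_min_spec
    (fun b r => domb st b && E b r) (fun x => (x == p) && ~~ domb st p) _ ok1 oo1.
- move=> x y; rewrite /= hc => /[swap] /andP[/eqP-> np].
  rewrite (sym_connect_sym (restrict_sym st sE)) => /fdom[->|]; first by rewrite eqxx.
  by rewrite (negPf np).
- by move=> b r /andP[/eqP-> _] /andP[db _]; rewrite !domb_touch db eqxx orbT.
rewrite -/(touch (L := Lb) E p st) in sp fE cE.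
set st' := touch (L := Lb) E p st in dE sp fE cE *.
have rE x y : restrictb E st' x y = [&& domb st' x, domb st' y & E x y] by [].
have sub : subrel (connect (restrictb E st)) (connect (restrictb E st')).
  by apply: connect_mono => x y /restrictbP[h1 h2 h3]; rewrite rE !dE h1 h2.
have csE := sym_connect_sym (restrict_sym st' sE).
have cs' x y : cn st' x y = cn st' y x.
  by rewrite !(spn_cn sp); apply: sym_connect_sym; apply: spn_sym.
split=> //.
- by case: oo1.
- move=> x y; apply/idP/idP.
    have Uc u r : anchor (L := Lb) (cn (touch_st p st))
        (min_link (L := Lb) (fun b r => domb st b && E b r)
        (fun x => (x == p) && ~~ domb st p) (touch_st p st))
        (fun x => (x == p) && ~~ domb st p) u r ->
        connect (restrictb E st') u p /\ r = p.
      move=> /U2[/andP[/eqP-> _]] [->//|[b [_ /andP[db e] cub]]]; split=> //.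
      rewrite /= hc in cub; apply: connect_trans (sub _ _ cub) (connect1 _).
      by rewrite rE !dE db eqxx orbT.
    case/cE => [|[r [s [/Uc[h1 _] /Uc[h2 _] _]]]]; first by rewrite /= hc => /sub.
    by apply: connect_trans h1 _; rewrite csE.
  rewrite (spn_cn sp); apply: connect_sub => {}x {}y.
  rewrite rE -(spn_cn sp) !dE => /and3P[dx dy e].
  have [dp|np] := boolP (domb st p).
    have d z : domb st z || (z == p) -> domb st z by case/orP => [//|/eqP->].
    apply/cE; left; rewrite /= hc connect1 //.
    by apply/and3P; split=> //; apply: d.
  have Upp : anchor (L := Lb) (cn (touch_st p st))
        (min_link (L := Lb) (fun b r => domb st b && E b r)
        (fun x => (x == p) && ~~ domb st p) (touch_st p st))
        (fun x => (x == p) && ~~ domb st p) p p by apply: U0; rewrite eqxx.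
  (* The edge from [z] to [p] is a candidate, so the tree of [z] gets a link, and [p] is the only
     possible anchor. *)
  have key z : domb st z -> E z p -> cn st' z p.
    move=> dz ez; apply/cE; right.
    have [||||r Ur] := U1 z z p; rewrite ?eqxx ?dz //.
    + by apply: contra np => /andP[/eqP<-].
    + by rewrite /= hc.
    have [/andP[/eqP er _] _] := U2 _ _ Ur; rewrite er in Ur.
    by exists p, p; split=> //; rewrite /= hc.
  case/orP: dx e => [dx|/eqP->]; case/orP: dy => [dy|/eqP->] e.
  + by apply/cE; left; rewrite /= hc connect1 //; apply/and3P.
  + exact: key.
  + by rewrite cs'; apply: key => //; rewrite sE.
  + by rewrite (spn_cn sp).
- move=> x y /fE[/hs/restrictbP[h1 h2 h3]|/and3P[/andP[/eqP-> _] h1 h2]|/and3P[/andP[/eqP-> _] h1 h2]].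
  + by rewrite rE !dE h1 h2.
  + by rewrite rE !dE h1 eqxx orbT.
  + by rewrite rE !dE h1 eqxx orbT sE.
- move=> u v nu nv; apply: hh.
  + by move: nu; rewrite dE negb_or => /andP[].
  + by move: nv; rewrite dE negb_or => /andP[].
Qed.

Lemma bridgedSP (C N : rel D) i x y :
  reflect (bridged (L := Lb) C N i x y \/ exists v u,
      [/\ bridged (L := Lb) C N i x v, N v u & C u y])
    (bridged (L := Lb) C N i.+1 x y).
Proof.
apply: (iffP orP) => -[h|]; try by left.
  by move=> /existsP[v /existsP[u /and3P[h1 h2 h3]]]; right; exists v, u.
by move=> [v [u h]]; right; apply/existsP; exists v; apply/existsP; exists u; apply/and3P.
Qed.

Lemma bridged_leq (C N : rel D) i j x y : i <= j ->
  bridged (L := Lb) C N i x y -> bridged (L := Lb) C N j x y.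
Proof.
move=> /subnK <-; elim: (j - i) => // k IH /IH h.
by rewrite addSn; apply/bridgedSP; left.
Qed.

(** If one further bridge reaches nothing new, neither does any larger number of bridges. *)
Definition bounded_by M (C N : rel D) :=
  forall x y, bridged (L := Lb) C N M.+1 x y -> bridged (L := Lb) C N M x y.

Lemma bridged_connect M (C N : rel D) : (forall x, C x x) ->
  subrel C (connect N) -> bounded_by M C N ->
  bridged (L := Lb) C N M =2 connect N.
Proof.
move=> hC sC hM x y; apply/idP/idP.
  elim: (M) y => [|i IH] y; first exact: sC.
  case/bridgedSP => [/IH//|[v [u [/IH h1 h2 /sC h3]]]].
  exact: connect_trans h1 (connect_trans (connect1 h2) h3).
move: x y; apply: connect_rind => [x|x y z h e].
  exact: (@bridged_leq _ _ 0).
by apply: hM; apply/bridgedSP; right; exists y, z.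
Qed.

(** * Rebuilding the forest round by round *)

Section Insertion.
Variables (M : nat) (N : rel D) (st : struct Lb).
Hypotheses (oo : ordered st) (ok : spanning st) (sN : symmetric N).
Hypothesis domN : forall x y, N x y -> domb st x /\ domb st y.
Hypothesis subN : subrel (connect (forestb st)) (connect N).
Hypothesis bound : bounded_by M (cn st) N.

Local Notation lvl i := (level (L := Lb) M N st i : pred D).
Local Notation rd i := (rounds (L := Lb) M N st i).

Lemma bridgedE : bridged (L := Lb) (cn st) N M =2 connect N.
Proof.
apply: bridged_connect => // [x|x y]; rewrite (spn_cn ok) //.
exact: subN.
Qed.

Lemma rootP r : reflect (domb st r /\ forall y, connect N r y -> le st r y)
  (root (L := Lb) M N st r).
Proof.
apply: (iffP andP) => -[dr h]; split=> //.
  move=> y; rewrite -bridgedE; move: h => /existsPn/(_ y); rewrite negbK.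
  by move=> /= /orP[/negPf->|].
apply/existsPn => y; rewrite negbK; apply/orP; rewrite bridgedE.
by case: (boolP (connect N r y)) => [/h|]; [right|left].
Qed.

Lemma levelP i x : reflect (exists2 r, root (L := Lb) M N st r & bridged (L := Lb) (cn st) N i r x)
  (lvl i x).
Proof.
apply: (iffP existsP) => [[r /andP[h1 h2]]|[r h1 h2]]; exists r => //.
exact/andP.
Qed.

Lemma root_uniq r s : root (L := Lb) M N st r -> root (L := Lb) M N st s ->
  connect N r s -> r = s.
Proof.
move=> /rootP[_ hr] /rootP[_ hs] c; apply: (ord_anti oo); first exact: hr.
by apply: hs; rewrite (sym_connect_sym sN).
Qed.

Lemma levelS i x : lvl i x -> lvl i.+1 x.
Proof. by case/levelP => r h1 h2; apply/levelP; exists r => //; apply/bridgedSP; left. Qed.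

Lemma le_rounds i : le (rd i) = le st.
Proof. by elim: i. Qed.

(** Inside level [i] the forest already joins what [N] connects and is closed off from the rest,
    while the trees outside are still the old ones. Level [i.+1] adds precisely the old trees with
    an [N]-edge into level [i], and these are the trees that the next round links. *)
Lemma rounds_inv i :
  [/\ spanning (rd i),
      forall x y, forestb (rd i) x y -> forestb st x y || N x y,
      forall x y, lvl i x -> lvl i y -> connect N x y -> cn (rd i) x y,
      forall x y, lvl i x -> cn (rd i) x y -> lvl i y &
      forall x y, ~~ lvl i x -> cn (rd i) x y = cn st x y].
Proof.
have sF := spn_sym ok; have hc := spn_cn ok; have cs := sym_connect_sym sF.
have csN := sym_connect_sym sN.
elim: i => [|i [sp fi ci li ni]].
  split; [exact: ok|by move=> x y; rewrite /= => ->| | |by []].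
    (* Level 0 consists of the trees of the roots, and a component of [N] has only one root. *)
    move=> x y /levelP[r hr /= rx] /levelP[s hs /= sy] cxy.
    have e : r = s.
      apply: root_uniq => //; rewrite !hc in rx sy.
      apply: connect_trans (subN rx) (connect_trans cxy _).
      by rewrite csN; apply: subN.
    rewrite -e !hc in rx sy *; apply: connect_trans sy; by rewrite cs.
  move=> x y /levelP[r hr /= rx] cxy; apply/levelP; exists r => //=.
  by move: rx cxy; rewrite !hc; apply: connect_trans.
have csi x y : cn (rd i) x y = cn (rd i) y x.
  by rewrite !(spn_cn sp); apply: sym_connect_sym; apply: spn_sym.
have oi : ordered (rd i).
  by case: oo => *; split; rewrite /domb /dom le_rounds.
have [||sp' [f' c'] U0 U1 U2] := @attach_min_spec N (lvl i) (rd i) sp oi.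
- by move=> x y /[swap]; apply: li.
- by move=> b r _ /domN; rewrite /domb /dom le_rounds.
rewrite -[attach_min _ _ _]/(rd i.+1) in sp' f' c'.
set U := anchor _ _ _ in c' U0 U1 U2.
have subi x y : cn (rd i) x y -> connect N x y.
  rewrite (spn_cn sp); apply: connect_sub => {}x {}y /fi/orP[h|]; last exact: connect1.
  by apply: subN; apply: connect1.
have UL x r : U x r -> lvl i.+1 x.
  move=> /U2[lr [->|[b [nb Nbr cxb]]]]; first exact: levelS.
  have [/levelS//|nx] := boolP (lvl i x).
  case/levelP: lr => t ht tr; apply/levelP; exists t => //; apply/bridgedSP; right.
  exists r, b; split=> //; first by rewrite sN.
  by rewrite -ni // csi.
have LU x : lvl i.+1 x -> exists r, U x r.
  move=> lx; have [h|nx] := boolP (lvl i x); first by exists x; apply: U0.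
  case/levelP: lx => t ht /bridgedSP[h|[v [u [tv Nvu cux]]]].
    by case/negP: nx; apply/levelP; exists t.
  apply: (U1 x u v) => //; last by rewrite sN.
    by rewrite ni // hc cs -hc.
  by apply/levelP; exists t.
have Uc x r : U x r -> connect N x r.
  case/U2=> _ [->|[b [_ Nbr /subi h]]]; first exact: connect0.
  exact: connect_trans h (connect1 Nbr).
split=> //.
- move=> x y /f'[/fi//|/andP[_ h]|/andP[_ h]]; apply/orP; right=> //.
  by rewrite sN.
- move=> x y /LU[r xr] /LU[s ys] cxy; apply/c'; right; exists r, s; split=> //.
  apply: ci; [by case: (U2 _ _ xr)|by case: (U2 _ _ ys)|].
  apply: connect_trans (connect_trans cxy (Uc _ _ ys)).
  by rewrite csN; apply: Uc.
- move=> x y lx /c'[cxy|[r [s [_ /UL]]]] //.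
  have [h|nx] := boolP (lvl i x); first by apply: levelS; apply: li cxy.
  case/levelP: lx => t ht /bridgedSP[h|[v [u [tv Nvu cux]]]].
    by case/negP: nx; apply/levelP; exists t.
  apply/levelP; exists t => //; apply/bridgedSP; right; exists v, u; split=> //.
  by move: cux cxy; rewrite ni // !hc; apply: connect_trans.
- move=> x y nx; have nx' : ~~ lvl i x by apply: contra nx; apply: levelS.
  rewrite -ni //; apply/idP/idP => [/c'[//|[r [s [/UL]]]]|h]; last by apply/c'; left.
  by rewrite (negPf nx).
Qed.

(** Every touched vertex is on level [M]: the least vertex of its component is a root and, by
    [bound], reaches it through [M] bridges. *)
Lemma rounds_cn x y : cn (rd M) x y = connect N x y.
Proof.
have [sp fi ci _ ni] := rounds_inv M.
have csN := sym_connect_sym sN.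
apply/idP/idP.
  rewrite (spn_cn sp); apply: connect_sub => {}x {}y /fi/orP[h|]; last exact: connect1.
  by apply: subN; apply: connect1.
have dc u v : connect N u v -> domb st u -> domb st v.
  move: u v; apply: connect_rind => // u v w h /domN[_ dw]; by [].
have lM u : domb st u -> lvl M u.
  move=> du; have [|m cm hm] := @ordered_min st (connect N u) u oo _ (connect0 _ _).
    by move=> v /dc; apply.
  apply/levelP; exists m; last by rewrite bridgedE csN.
  apply/rootP; split; first exact: dc cm du.
  by move=> v h; apply: hm; apply: connect_trans h.
move=> cxy; case/connectP: (cxy) => -[|z p] /=.
  by move=> _ ->; rewrite (spn_cn sp) connect0.
move=> /andP[/domN[dx _] _] _; apply: ci => //; apply: lM => //.
exact: dc cxy dx.
Qed.

End Insertion.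

Lemma insert_good M E E' st : symmetric E' -> subrel E E' -> good E st ->
  (forall u v, ~~ domb st u -> ~~ domb st v ->
    forall x y, E' (tperm u v x) (tperm u v y) = E' x y) ->
  bounded_by M (cn st) (restrictb E' st) ->
  good E' (insert (L := Lb) M E' st).
Proof.
move=> sE' sub [oo ok hc hs hh] hh' hM.
have sN := restrict_sym st sE'.
have domN x y : restrictb E' st x y -> domb st x /\ domb st y by case/restrictbP.
have subr : subrel (restrictb E st) (restrictb E' st).
  by move=> x y /restrictbP[? ? /sub ?]; apply/restrictbP.
have subN : subrel (connect (forestb st)) (connect (restrictb E' st)).
  by apply: connect_mono => x y /hs/subr.
have [sp fi _ _ _] := rounds_inv oo ok sN domN subN hM M.
have dE x : domb (insert (L := Lb) M E' st) x = domb st x.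
  by rewrite /domb /dom le_rounds.
split=> //.
- by case: oo => *; split; rewrite /domb /dom le_rounds.
- move=> x y; rewrite (rounds_cn oo ok sN domN subN hM).
  by apply: eq_connect => u v; rewrite /restrictb /restrict -!/(domb _ _) !dE.
- move=> x y /fi h; have /restrictbP[h1 h2 h3] : restrictb E' st x y.
    by case/orP: h => [/hs/subr|].
  by apply/restrictbP; rewrite !dE.
- by move=> u v; rewrite !dE; apply: hh'.
Qed.

Lemma delete_good a b E E' st : symmetric E -> E' =2 delb E a b -> good E st ->
  (forall u v, ~~ domb st u -> ~~ domb st v ->
    forall x y, E' (tperm u v x) (tperm u v y) = E' x y) ->
  good E' (delete (L := Lb) a b E' st).
Proof.
move=> sE eE [oo ok hc hs hh] hh'; have [sF hF _ ac] := ok.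
have sE' : symmetric E' by move=> x y; rewrite !eE delb_sym.
have sN := restrict_sym st sE'.
have ok1 := spanning_cut a b ok.
have oo1 : ordered (cut (L := Lb) a b st) by case: oo.
have cutE := cut_cnE a b ok.
set F := forestb st in sF hF ac hs cutE.
have sF1 := delb_sym a b sF; have cs1 := sym_connect_sym sF1.
have [||sp [fE cE] U0 U1 U2] := @attach_min_spec (restrictb E' st)
    (fun x => F a b && cut_cn (L := Lb) st a b b x) _ ok1 oo1.
- move=> x y cxy /andP[-> h] /=; rewrite !cutE in h *; apply: connect_trans h _.
  by rewrite -cutE.
- by move=> u v _ /restrictbP[].
rewrite -[attach_min _ _ _]/(delete (L := Lb) a b E' st) in sp fE cE.
set st' := delete _ _ _ _ in sp fE cE *.
set U := anchor _ _ _ in cE U0 U1 U2.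
have rE : restrictb E' st' = restrictb E' st by [].
have sub' : subrel (forestb st') (restrictb E' st).
  move=> x y /fE[|/andP[_ //]|/andP[_]]; last by rewrite sN.
  rewrite forest_cut // => /andP[/hs/restrictbP[dx dy e] ns].
  by apply/restrictbP; split=> //; rewrite eE /delb /del /= e.
have cs' x y : cn st' x y = cn st' y x.
  by rewrite !(spn_cn sp); apply: sym_connect_sym; apply: spn_sym.
have cutc x y : cn (cut (L := Lb) a b st) x y = connect (delb F a b) x y by exact: cutE.
(* An edge crossing the cut is a candidate, so the side of [a] gets an anchor on the side of [b],
   though possibly at another vertex than [y]. *)
have key x y : F a b -> connect (delb F a b) x a -> connect (delb F a b) b y ->
    restrictb E' st x y -> cn st' x y.
  move=> fab xa by_ e; have Ry : F a b && cut_cn (L := Lb) st a b b y by rewrite fab cutE.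
  have nRx : ~~ (F a b && cut_cn (L := Lb) st a b b x).
    rewrite fab cutE /=; apply: contra (ac _ _ fab) => bx.
    by rewrite cs1; apply: connect_trans bx xa.
  have cxx : cn (cut (L := Lb) a b st) x x by rewrite cutc.
  have [r xr] := U1 _ _ _ nRx cxx Ry e.
  apply/cE; right; exists r, y; split=> //; first exact: U0.
  have [/andP[_]] := U2 _ _ xr; rewrite cutE cutc => br _.
  by apply: connect_trans by_; rewrite cs1.
split=> //.
- by case: oo.
- move=> x y; rewrite rE; apply/idP/idP; rewrite (spn_cn sp).
    exact: connect_mono.
  apply: connect_sub => {}x {}y e; rewrite -(spn_cn sp).
  have cxy : connect F x y.
    rewrite -hF hc connect1 //; case/restrictbP: e => dx dy.
    by rewrite eE => /delb_sub e; apply/restrictbP.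
  have [fab|nab] := boolP (F a b); last first.
    by apply/cE; left; rewrite cutc (eq_connect (delb_id sF nab)).
  case: (connect_del_split a b cxy) => [h|[h1 h2]|[h1 h2]].
  + by apply/cE; left; rewrite cutc.
  + exact: key.
  + rewrite cs'; apply: key => //; by [rewrite cs1|rewrite cs1|rewrite sN].
Qed.

(** A path among touched elements is seen by the forest; one among untouched elements shrinks to an
    edge or a point by homogeneity. Any passage between the two kinds makes [borders] true, and
    [bstep] carries it along edges to both ends. *)
Lemma connectedE E st : symmetric E -> good E st ->
  connected (L := Lb) E st =2 connect E.
Proof.
move=> sE [oo ok hc hs hh] x y.
have sR := restrict_sym st sE; have csR := sym_connect_sym sR.
have csE := sym_connect_sym sE.
have sub u v : cn st u v -> connect E u v.
  by rewrite hc; apply: connect_mono => {}u {}v /restrictbP[].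
have refl u : cn st u u by rewrite hc connect0.
have tr u v w : cn st u v -> cn st v w -> cn st u w.
  by rewrite !hc; apply: connect_trans.
have edge u v : domb st u -> domb st v -> E u v -> cn st u v.
  by move=> du dv e; rewrite hc connect1 //; apply/restrictbP.
have cdom u v : cn st u v -> u = v \/ domb st u /\ domb st v.
  rewrite hc; case/connectP => -[|w p] /=; first by left.
  move=> /andP[/restrictbP[du dw _]]; elim: p w dw => [|z p IH] w dw /=.
    by move=> _ ->; right.
  by case/andP => /restrictbP[_ dz _]; apply: IH.
have hom t u w : domb st t -> ~~ domb st u -> ~~ domb st w -> E t u -> E t w.
  move=> dt du dw; rewrite -(hh u w du dw t u) tpermL tpermD //.
  - by apply: contra du => /eqP->.
  - by apply: contra dw => /eqP->.
have borP u : reflect (exists t w, [/\ domb st t, ~~ domb st w, E t w &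
    cn st u t \/ ~~ domb st u]) (borders (L := Lb) E st u).
  apply: (iffP existsP) => -[t]; last first.
    case=> w [h1 h2 h3 h4]; exists t; apply/existsP; exists w.
    by apply/and4P; split=> //; apply/orP.
  by case/existsP=> w /and4P[h1 h2 h3 /orP h4]; exists t, w.
have conP u v : reflect [\/ cn st u v, E u v |
    borders (L := Lb) E st u && borders (L := Lb) E st v] (connected (L := Lb) E st u v).
  exact: or3P.
have bor u w : borders (L := Lb) E st u -> ~~ domb st w -> connect E u w.
  move=> /borP[t [v [dt nv e [ut|nu]]]] nw.
    apply: connect_trans (sub _ _ ut) (connect1 _); exact: hom e.
  apply: (@connect_trans _ _ t); last by apply: connect1; apply: hom e.
  by rewrite csE; apply: connect1; apply: hom e.
have bnew t u : domb st t -> ~~ domb st u -> E t u ->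
    borders (L := Lb) E st t /\ borders (L := Lb) E st u.
  by move=> dt nu e; split; apply/borP; exists t, u; split=> //; [left|right].
have bcn u v : cn st u v -> borders (L := Lb) E st v -> borders (L := Lb) E st u.
  move=> cuv /borP[t [w [dt nw e h]]]; apply/borP; exists t, w; split=> //.
  by case: h => h; [left; apply: tr h|case: (cdom _ _ cuv) => [->|[_]]; [right|rewrite (negPf h)]].
have bout u v : borders (L := Lb) E st u -> ~~ domb st v -> borders (L := Lb) E st v.
  by move=> /borP[t [w [dt nw e _]]] nv; apply/borP; exists t, w; split=> //; right.
have bstep u v : borders (L := Lb) E st u -> E u v -> borders (L := Lb) E st v.
  move=> bu e; have [dv|nv] := boolP (domb st v); last exact: bout bu nv.
  have [du|nu] := boolP (domb st u); last by rewrite sE in e; have [] := bnew _ _ dv nu e.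
  by apply: bcn bu; apply: edge => //; rewrite sE.
have csn u v : cn st u v = cn st v u by rewrite !hc csR.
apply/conP/idP => [[/sub//|/connect1//|/andP[bx By]]|].
  have /borP[_ [w [_ nw _ _]]] := bx.
  by apply: connect_trans (bor _ _ bx nw) _; rewrite csE; apply: bor.
move: x y; apply: connect_rind => [x|x y z h e]; first by apply: Or31.
have cut_case : borders (L := Lb) E st x -> borders (L := Lb) E st z ->
    [\/ cn st x z, E x z | borders (L := Lb) E st x && borders (L := Lb) E st z].
  by move=> -> ->; apply: Or33.
have [dy|ny] := boolP (domb st y); have [dz|nz] := boolP (domb st z).
- have cyz := edge _ _ dy dz e.
  case: h => [c|exy|/andP[bx By]]; first by apply: Or31; apply: tr cyz.
    have [dx|nx] := boolP (domb st x); first by apply: Or31; apply: tr cyz; apply: edge.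
    rewrite sE in exy; have [b1 b2] := bnew _ _ dy nx exy.
    by apply: cut_case => //; apply: bcn b1; rewrite csn.
  by apply: cut_case => //; apply: bstep e.
- have [By bz] := bnew _ _ dy nz e.
  apply: cut_case => //; case: h => [c|exy|/andP[]//]; first exact: bcn By.
  by apply: bstep By _; rewrite sE.
- rewrite sE in e; have [bz By] := bnew _ _ dz ny e.
  apply: cut_case => //; case: h => [c|exy|/andP[]//]; first exact: bcn By.
  by apply: bstep By _; rewrite sE.
- case: h => [c|exy|/andP[bx By]].
  + by case: (cdom _ _ c) => [->|[_]]; [apply: Or32|rewrite (negPf ny)].
  + have [dx|nx] := boolP (domb st x).
      have [bx By] := bnew _ _ dx ny exy; apply: cut_case => //; exact: bout bx nz.
    have [->|xz] := eqVneq x z; first by apply: Or31.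
    (* Transposing [x] and [y] carries the edge [yz] to [xz]. *)
    apply: Or32; have [ezy|zy] := eqVneq z y; first by rewrite ezy.
    by rewrite -(hh x y nx ny x z) tpermL tpermD // eq_sym.
  + by apply: cut_case => //; apply: bout bx nz.
Qed.

End States.

(** * Rank types and swapping of components *)

Fixpoint qrank (S : Type) (f : fo S) : nat :=
  match f with
  | FRel _ _ | FEq _ _ => 0
  | FNot g => qrank g
  | FAnd g h | FOr g h => maxn (qrank g) (qrank h)
  | FEx g | FAll g => (qrank g).+1
  end.

Lemma eval_FRel_graph (D : finType) (E : rel D) env args :
  eval (graph_interp E) env (FRel tt args) =
    if args is [:: i; j] then
      if (onth env i, onth env j) is (Some x, Some y) then E x y else false
    else false.
Proof.
case: args => [|i [|j [|k s]]] //=; case: onth => //= a; case: onth => //= b.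
by case: onth => //= c; case: lookup_all.
Qed.

Lemma eval_perm (D : finType) (E : rel D) (p : {perm D}) f env :
  (forall x y, E (p x) (p y) = E x y) ->
  eval (graph_interp E) (map p env) f = eval (graph_interp E) env f.
Proof.
move=> hE; elim: f env => [[] args|i j|g IH|g IHg h IHh|g IHg h IHh|g IH|g IH] env.
- rewrite !eval_FRel_graph; case: args => [|i [|j []]] //.
  by rewrite !onth_map; case: onth => //= a; case: onth => //= b; rewrite hE.
- rewrite /= !onth_map; case: onth => //= a; case: onth => //= b.
  by rewrite (inj_eq perm_inj).
- by rewrite /= IH.
- by rewrite /= IHg IHh.
- by rewrite /= IHg IHh.
- rewrite /=; apply/existsP/existsP => -[d h].
    by exists (p^-1%g d); rewrite -IH /= permKV.
  by exists (p d); rewrite -map_cons IH.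
- rewrite /=; apply/forallP/forallP => h d.
    by rewrite -IH; apply: h.
  by have := h (p^-1%g d); rewrite -IH /= permKV.
Qed.

Section Types.
Variable N : nat.

(** A finite type independent of the domain, so that types can be counted; [N] bounds the length of
    the environments met during evaluation. *)
Definition atype : finType := {ffun 'I_N * 'I_N -> bool * bool * bool}.

Fixpoint rtype (r : nat) : finType :=
  if r is r'.+1 then (atype * ({set rtype r'} * rtype r'))%type else atype.

Variables (D : finType) (E : rel D) (col : pred D).

Definition atom_of (env : seq (option D)) : atype :=
  [ffun p : 'I_N * 'I_N =>
    let x := nth None env p.1 in let y := nth None env p.2 in
    (x == y, if (x, y) is (Some a, Some b) then E a b else false,
     if x is Some a then col a else false)].

(* The rank-r type of a tuple inside the induced structure on X, where an
   entry None stands for an element outside X. *)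
Fixpoint tp (X : {set D}) r (env : seq (option D)) : rtype r :=
  match r return rtype r with
  | 0 => atom_of env
  | r'.+1 => (atom_of env,
      ([set tp X r' (Some d :: env) | d in X], tp X r' (None :: env)))
  end.

Lemma tp_atom X Y r e1 e2 : tp X r e1 = tp Y r e2 -> atom_of e1 = atom_of e2.
Proof. by case: r => [|r] //= []. Qed.

Definition proj (X : {set D}) (e : seq D) : seq (option D) :=
  [seq if d \in X then Some d else None | d <- e].

(* Exchanging X and Y is undetectable because both see the elements outside only
   through the colour [col]. *)
Section Swap.
Variables (X Y : {set D}) (out : pred D).
Hypothesis disXY : forall x, x \in X -> x \in Y -> False.
Hypothesis noXY : forall x y, x \in X -> y \in Y -> E x y = false /\ E y x = false.
Hypothesis colXY : forall x z, (x \in X) || (x \in Y) -> z \notin X -> z \notin Y ->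
  E x z = col x && out z /\ E z x = col x && out z.

(** A relation and not a bijection: partners in the two components are chosen only as quantifiers
    are met. *)
Definition swapped (x y : D) : bool :=
  [|| [&& x == y, x \notin X & x \notin Y], (x \in X) && (y \in Y) |
      (x \in Y) && (y \in X)].

Lemma swapped_sym x y : swapped x y -> swapped y x.
Proof.
case/or3P => [/and3P[/eqP-> h1 h2]|/andP[h1 h2]|/andP[h1 h2]]; apply/or3P.
- by apply: Or31; rewrite eqxx h1.
- by apply: Or33; rewrite h2.
- by apply: Or32; rewrite h2.
Qed.

(** A position in an Ehrenfeucht-Fraisse game of the structure against itself, with [r] moves
    left. *)
Definition sim r e1 e2 := [/\ all2 swapped e1 e2,
  tp X r (proj X e1) = tp Y r (proj Y e2) &
  tp Y r (proj Y e1) = tp X r (proj X e2)].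

Lemma sim_sym r e1 e2 : sim r e1 e2 -> sim r e2 e1.
Proof.
case=> h h1 h2; split=> //.
elim: e1 e2 h {h1 h2} => [|x e1 IH] [|y e2] //= /andP[/swapped_sym -> /IH].
by [].
Qed.

(** Inside [X] or [Y] the equality of types provides the answer, the other projection being extended
    by [None] on both sides; an element outside answers itself. *)
Lemma sim_step r e1 e2 d : sim r.+1 e1 e2 -> exists d', sim r (d :: e1) (d' :: e2).
Proof.
case=> h [_ hX nX] [_ hY nY].
have [dX|dX] := boolP (d \in X).
  have dY : d \in Y = false by apply/negP => /(disXY dX).
  have : tp X r (Some d :: proj X e1) \in [set tp X r (Some d :: proj X e1) | d in X].
    exact: imset_f.
  rewrite hX => /imsetP[d' dY' e]; exists d'.
  have dX' : d' \in X = false by apply/negP => /disXY; apply.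
  by split; rewrite /= /swapped ?dX ?dY ?dY' ?dX' ?orbT.
have [dY|dY] := boolP (d \in Y).
  have : tp Y r (Some d :: proj Y e1) \in [set tp Y r (Some d :: proj Y e1) | d in Y].
    exact: imset_f.
  rewrite hY => /imsetP[d' dX' e]; exists d'.
  have dY' : d' \in Y = false by apply/negP => /(disXY dX').
  by split; rewrite /= /swapped ?(negPf dX) ?dY ?dY' ?dX' ?orbT.
exists d; split; rewrite /= /swapped ?eqxx ?(negPf dX) ?(negPf dY) //=.
Qed.

Lemma nth_proj Z e i x : onth e i = Some x ->
  nth None (proj Z e) i = if x \in Z then Some x else None.
Proof.
move=> h; have lt : i < size e by have := onthTE e i; rewrite h.
by rewrite (nth_map x) // (onth_nth x _ _ _ h).
Qed.

Lemma onth_all2 e1 e2 i : all2 swapped e1 e2 ->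
  match onth e1 i, onth e2 i with
  | Some x, Some y => swapped x y
  | None, None => true
  | _, _ => false
  end.
Proof.
elim: e1 e2 i => [|x e1 IH] [|y e2] i //=; first by rewrite !onth0n.
by case/andP=> h1 h2; case: i => //= i; apply: IH.
Qed.

(** Two elements of one component are compared by its type, elements of different components are
    never adjacent, and adjacency to an outside element depends on the colour alone. *)
Lemma sim_atom r e1 e2 i j x y x' y' : sim r e1 e2 -> size e1 <= N ->
  onth e1 i = Some x -> onth e1 j = Some y ->
  onth e2 i = Some x' -> onth e2 j = Some y' ->
  (x == y) = (x' == y') /\ E x y = E x' y'.
Proof.
case=> h /tp_atom hX /tp_atom hY leN ix jy ix' jy'.
have li : i < N by apply: leq_trans leN; have := onthTE e1 i; rewrite ix.
have lj : j < N by apply: leq_trans leN; have := onthTE e1 j; rewrite jy.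
have sx := onth_all2 i h; rewrite ix ix' in sx.
have sy := onth_all2 j h; rewrite jy jy' in sy.
(* An atom stores the colour of its first position only, so both orders of the pair are
   consulted. *)
pose ij := (Ordinal li, Ordinal lj); pose ji := (Ordinal lj, Ordinal li).
have cXi := congr1 (fun t : atype => (t ij).2) hX.
have cYi := congr1 (fun t : atype => (t ij).2) hY.
have cXj := congr1 (fun t : atype => (t ji).2) hX.
have cYj := congr1 (fun t : atype => (t ji).2) hY.
have eX := congr1 (fun t : atype => (t ij).1) hX.
have eY := congr1 (fun t : atype => (t ij).1) hY.
have pE Z := (nth_proj Z ix, nth_proj Z jy, nth_proj Z ix', nth_proj Z jy').
rewrite !ffunE /= !pE in cXi cYi cXj cYj eX eY.
clear hX hY pE ij ji h.
have nXY z : z \in X -> z \in Y = false by move=> zX; apply/negP => /(disXY zX).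
have nYX z : z \in Y -> z \in X = false by move=> zY; apply/negP => /disXY; apply.
have ne u v (Z : {set D}) : u \in Z -> v \in Z = false -> (u == v) = false.
  by move=> uZ vZ; apply/eqP => e; rewrite -e uZ in vZ.
have ne' u v (Z : {set D}) : u \in Z -> v \in Z = false -> (v == u) = false.
  by move=> uZ vZ; rewrite eq_sym (ne _ _ _ uZ vZ).
case/or3P: sx => [/and3P[/eqP ex /negPf nx /negPf mx]|/andP[xX xY]|/andP[xY xX]];
case/or3P: sy => [/and3P[/eqP ey /negPf ny /negPf my]|/andP[yX yY]|/andP[yY yX]].
- by rewrite ex ey.
- rewrite -{}ex in cXi cYi cXj cYj eX eY *.
  rewrite (ne' _ _ _ yX nx) (ne' _ _ _ yY mx); split=> //.
  rewrite yX yY in cXj.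
  have [_ ->] := @colXY y x (introT orP (or_introl yX)) (negbT nx) (negbT mx).
  have [_ ->] := @colXY y' x (introT orP (or_intror yY)) (negbT nx) (negbT mx).
  by rewrite cXj.
- rewrite -{}ex in cXi cYi cXj cYj eX eY *.
  rewrite (ne' _ _ _ yY mx) (ne' _ _ _ yX nx); split=> //.
  rewrite yX yY in cYj.
  have [_ ->] := @colXY y x (introT orP (or_intror yY)) (negbT nx) (negbT mx).
  have [_ ->] := @colXY y' x (introT orP (or_introl yX)) (negbT nx) (negbT mx).
  by rewrite cYj.
- rewrite -{}ey in cXi cYi cXj cYj eX eY *.
  rewrite (ne _ _ _ xX ny) (ne _ _ _ xY my); split=> //.
  rewrite xX xY in cXi.
  have [-> _] := @colXY x y (introT orP (or_introl xX)) (negbT ny) (negbT my).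
  have [-> _] := @colXY x' y (introT orP (or_intror xY)) (negbT ny) (negbT my).
  by rewrite cXi.
- by rewrite xX xY yX yY in eX; case: eX.
- rewrite (ne _ _ _ xX (nYX _ yY)) (ne _ _ _ xY (nXY _ yX)); split=> //.
  by have [-> _] := noXY xX yY; have [_ ->] := noXY yX xY.
- rewrite -{}ey in cXi cYi cXj cYj eX eY *.
  rewrite (ne _ _ _ xY my) (ne _ _ _ xX ny); split=> //.
  rewrite xX xY in cYi.
  have [-> _] := @colXY x y (introT orP (or_intror xY)) (negbT ny) (negbT my).
  have [-> _] := @colXY x' y (introT orP (or_introl xX)) (negbT ny) (negbT my).
  by rewrite cYi.
- rewrite (ne _ _ _ xY (nXY _ yX)) (ne _ _ _ xX (nYX _ yY)); split=> //.
  by have [_ ->] := noXY yX xY; have [-> _] := noXY xX yY.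
- by rewrite xX xY yX yY in eY; case: eY.
Qed.

Lemma sim_eval r e1 e2 f : sim r e1 e2 -> qrank f <= r -> size e1 + qrank f <= N ->
  eval (graph_interp E) e1 f = eval (graph_interp E) e2 f.
Proof.
elim: f r e1 e2 => [[] args|i j|g IH|g IHg h IHh|g IHg h IHh|g IH|g IH] r e1 e2 s lr lN.
- rewrite !eval_FRel_graph; case: args lr lN => [|i [|j []]] // lr; rewrite addn0 => lN.
  have [h _ _] := s; have := onth_all2 i h; have := onth_all2 j h.
  case ei: (onth e1 i) => [x|]; case ei': (onth e2 i) => [x'|] //.
  case ej: (onth e1 j) => [y|]; case ej': (onth e2 j) => [y'|] // _ _.
  by have [] := sim_atom s lN ei ej ei' ej'.
- rewrite /= addn0 in lN *.
  have [h _ _] := s; have := onth_all2 i h; have := onth_all2 j h.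
  case ei: (onth e1 i) => [x|]; case ei': (onth e2 i) => [x'|] //.
  case ej: (onth e1 j) => [y|]; case ej': (onth e2 j) => [y'|] // _ _.
  by have [] := sim_atom s lN ei ej ei' ej'.
- by rewrite /= (IH r e1 e2).
- rewrite /= geq_max in lr; case/andP: lr => l1 l2.
  rewrite /= addn_maxr geq_max in lN; case/andP: lN => n1 n2.
  by rewrite /= (IHg r e1 e2) // (IHh r e1 e2).
- rewrite /= geq_max in lr; case/andP: lr => l1 l2.
  rewrite /= addn_maxr geq_max in lN; case/andP: lN => n1 n2.
  by rewrite /= (IHg r e1 e2) // (IHh r e1 e2).
- case: r s lr => // r s lr; rewrite /= addnS -addSn in lN.
  have sz : size e1 = size e2.
    by case: s => h _ _; move: h; rewrite all2E => /andP[/eqP].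
  rewrite /=; apply/existsP/existsP => -[d hd].
    have [d' s'] := sim_step d s; exists d'.
    by rewrite -(IH _ _ _ s').
  have [d' s'] := sim_step d (sim_sym s); exists d'.
  by rewrite -(IH _ _ _ s') //= -sz.
- case: r s lr => // r s lr; rewrite /= addnS -addSn in lN.
  have sz : size e1 = size e2.
    by case: s => h _ _; move: h; rewrite all2E => /andP[/eqP].
  rewrite /=; apply/forallP/forallP => hd d.
    have [d' s'] := sim_step d (sim_sym s).
    by rewrite (IH _ _ _ s') //= -sz.
  have [d' s'] := sim_step d s.
  by rewrite (IH _ _ _ s').
Qed.

End Swap.
End Types.

(** * Bounded number of bridges *)

Definition define (D : finType) (mu : fo unit) (a : seq D) (E : rel D) : rel D :=
  fun x y => eval (graph_interp E) (a ++ [:: x; y]) mu.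

Section Bound.
Variables (mu : fo unit) (k : nat).
Let r := qrank mu.
Let N := k.+2 + r.

(* Either a parameter lying in the tree of v, or the types of that tree with and
   without v marked; [k] positions are reserved for the parameters and two for
   the endpoints of an edge. *)
Definition label : finType := ('I_k + rtype N r * rtype N r)%type.
(** Depends on the formula and its number of parameters alone, hence can serve as the number of
    rounds of a fixed program. *)
Definition bridge_bound := #|label|.

Variables (D : finType) (E : rel D) (st : struct (bool_logic D)) (a : seq D).
Hypotheses (sE : symmetric E) (gd : good E st) (sa : size a = k).
Hypothesis da : all (domb st) a.

Let comp v := [set z | (cn st v z : bool)].
(** Outside its own tree a touched vertex is adjacent to untouched elements only, and to all of them
    or none. *)
Let col (x : D) := [exists w, ~~ domb st w && E x w].
Let nones := nseq k (None : option D).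

Definition label_of (v : D) : label :=
  if [pick m : 'I_k | if onth a m is Some p then cn st v p else false] is Some m
  then inl m
  else inr (tp N E col (comp v) r (nones ++ [:: Some v; None]),
            tp N E col (comp v) r (nones ++ [:: None; None])).

Lemma cn_refl x : cn st x x.
Proof. by rewrite (good_cn gd) connect0. Qed.

Lemma cn_sym x y : cn st x y = cn st y x.
Proof. rewrite !(good_cn gd); exact: sym_connect_sym (restrict_sym st sE) _ _. Qed.

Lemma cn_trans y x z : cn st x y -> cn st y z -> cn st x z.
Proof. by rewrite !(good_cn gd); apply: connect_trans. Qed.

Lemma cn_dom x y : cn st x y -> domb st x -> domb st y.
Proof.
rewrite (good_cn gd); move: x y; apply: connect_rind => [//|x y z IH].
by case/restrictbP.
Qed.

Lemma adj_untouched t u w : domb st t -> ~~ domb st u -> ~~ domb st w ->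
  E t u -> E t w.
Proof.
move=> dt du dw; rewrite -(good_hom gd du dw t u) tpermL tpermD //.
- by apply: contra du => /eqP->.
- by apply: contra dw => /eqP->.
Qed.

(** A common parameter label would put [v] and [v'] in one tree. Otherwise neither the parameters
    nor [u] lie in the two trees, and exchanging these matches the environments [a, v, u] and
    [a, v', u]. *)
Lemma label_shortcut v v' u : domb st v -> domb st v' -> ~~ cn st v v' ->
  ~~ cn st v u -> ~~ cn st v' u -> label_of v = label_of v' ->
  define mu a E v u = define mu a E v' u.
Proof.
move=> dv dv' nvv' nvu nv'u; rewrite /label_of.
case: pickP => [m|h]; case: pickP => [m'|h'].
- move=> h2 h1 [em]; rewrite -{}em in h2; case: onth h1 h2 => // p vp v'p.
  by case/negP: nvv'; apply: cn_trans vp _; rewrite cn_sym.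
- by [].
- by [].
case=> e1 e2; rewrite /define.
have notin w : (forall x : 'I_k, (if onth a x is Some p then cn st w p else false) = false) ->
    {in a, forall p, p \in comp w = false}.
  move=> hw p /onthP[i ip]; have lk : i < k by have := onthTE a i; rewrite ip -sa.
  by have := hw (Ordinal lk); rewrite /= ip inE.
have proj_a w : {in a, forall p, p \in comp w = false} -> proj (comp w) a = nones.
  rewrite /nones -sa; elim: (a) => [//|p b IH] h0 /=.
  by rewrite h0 ?mem_head // IH // => q qb; apply: h0; rewrite inE qb orbT.
have na := notin _ h; have na' := notin _ h'.
have [pa pa'] := (proj_a _ na, proj_a _ na').
have nv'v : ~~ cn st v' v by rewrite cn_sym.
have sub : (qrank mu <= r) && (size (a ++ [:: v; u]) + qrank mu <= N).
  by rewrite leqnn /= size_cat sa /= addn2.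
case/andP: sub => l1 l2; apply: (@sim_eval N D E col (comp v) (comp v') (predC (domb st))) l1 l2.
- move=> x; rewrite !inE => vx v'x; case/negP: nvv'.
  by apply: cn_trans vx _; rewrite cn_sym.
- move=> x y; rewrite !inE => vx v'y.
  suff nxy : E x y = false by rewrite (sE y x) nxy.
  apply/negP => e; case/negP: nvv'; apply: (cn_trans vx).
  apply: (@cn_trans y); last by rewrite cn_sym.
  rewrite (good_cn gd) connect1 //; apply/restrictbP; split=> //.
    exact: cn_dom vx dv.
  exact: cn_dom v'y dv'.
- move=> x z hx hz hz'; rewrite (sE z x).
  suff -> : E x z = col x && ~~ domb st z by [].
  have dx : domb st x by case/orP: hx; rewrite inE => /cn_dom; apply.
  have [dz|nz] /= := boolP (domb st z).
    rewrite andbF; apply/negP => e.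
    have cxz : cn st x z by rewrite (good_cn gd) connect1 //; apply/restrictbP.
    case/orP: hx; rewrite inE => c.
      by case/negP: hz; rewrite inE; apply: cn_trans cxz.
    by case/negP: hz'; rewrite inE; apply: cn_trans cxz.
  rewrite andbT; apply/idP/existsP => [e|[w /andP[nw e]]]; first by exists z; rewrite nz.
  exact: adj_untouched e.
split.
- have : all2 (swapped (comp v) (comp v')) [:: v; u] [:: v'; u].
    by rewrite /= /swapped !inE !cn_refl (negPf nvu) (negPf nv'u) eqxx !orbT.
  elim: (a) na na' => [//|p b IH] n1 n2 h2 /=.
  rewrite {1}/swapped eqxx n1 ?mem_head // n2 ?mem_head //=.
  by apply: IH h2 => q qb; [apply: n1|apply: n2]; rewrite inE qb orbT.
- by rewrite /proj !map_cat -!/(proj _ _) pa pa' /= !inE !cn_refl (negPf nvu) (negPf nv'u).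
- rewrite /proj !map_cat -!/(proj _ _) pa pa' /= !inE (negPf nvv') (negPf nv'v).
  by rewrite (negPf nvu) (negPf nv'u).
Qed.

Let Nw := restrictb (define mu a E) st.

(** Bridge distance exactly [i] from [x]. *)
Definition fresh x i v := bridged (L := bool_logic D) (cn st) Nw i x v /\
  forall j, j < i -> ~~ bridged (L := bool_logic D) (cn st) Nw j x v.

Lemma bridged_cn i x v w : bridged (L := bool_logic D) (cn st) Nw i x v ->
  cn st v w -> bridged (L := bool_logic D) (cn st) Nw i x w.
Proof.
elim: i => [|i IH]; first exact: cn_trans.
case/bridgedSP => [h c|[p [q [h1 h2 h3]]] c]; apply/bridgedSP.
  by left; apply: IH.
by right; exists p, q; split=> //; apply: cn_trans c.
Qed.

Lemma fresh_step x i w : fresh x i.+1 w ->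
  exists p : D * D, [/\ fresh x i p.1, Nw p.1 p.2 & fresh x i.+1 p.2].
Proof.
case=> /bridgedSP[h|[v [u [h1 h2 h3]]]] hw.
  by have := hw _ (ltnSn i); rewrite h.
exists (v, u); split=> //=; split=> //.
- move=> j ji; apply/negP => h; case/negP: (hw j.+1 ji); apply/bridgedSP; right.
  by exists v, u.
- by apply/bridgedSP; right; exists v, u; split=> //; apply: cn_refl.
- move=> j ji; apply/negP => h; case/negP: (hw _ ji); exact: bridged_cn h h3.
Qed.

(** A vertex at distance [bridge_bound.+1] yields, for each [i] up to [bridge_bound], a bridge from
    distance [i] to [i.+1]: one source more than there are labels. If sources [i < j] share a label,
    the bridge at [j] can start at the source [i], reaching distance [j.+1] with only [i.+1]
    bridges. *)
Lemma bridge_boundP : bounded_by bridge_bound (cn st) Nw.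
Proof.
move=> x y hy; apply/negPn/negP => ny.
have fy : fresh x bridge_bound.+1 y.
  split=> // j; rewrite ltnS => lj; apply/negP => h; case/negP: ny.
  exact: bridged_leq h.
have steps n : n <= bridge_bound -> exists p : D * D,
    [/\ fresh x (bridge_bound - n) p.1, Nw p.1 p.2 &
        fresh x (bridge_bound - n).+1 p.2].
  elim: n => [_|n IH lt]; first by rewrite subn0; apply: fresh_step fy.
  case: (IH (ltnW lt)) => p [fp _ _]; move: fp.
  rewrite -(subnSK lt); exact: fresh_step.
have /fin_all_exists[f hf] : forall i : 'I_bridge_bound.+1, exists p : D * D,
    [/\ fresh x i p.1, Nw p.1 p.2 & fresh x i.+1 p.2].
  move=> i; have := steps (bridge_bound - i) (leq_subr _ _).
  by rewrite subKn // -ltnS.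
have /injectivePn[i [j ij e]] : ~~ injectiveb (fun i => label_of (f i).1).
  apply/injectiveP => inj; have := leq_card _ inj.
  by rewrite card_ord ltnn.
wlog lt : i j ij e / i < j.
  move=> H; case: (ltngtP i j) => [|lt|/val_inj eij]; first exact: H.
    by apply: (H j i) => //; rewrite eq_sym.
  by rewrite eij eqxx in ij.
have [[bi fi] /restrictbP[di _ _] _] := hf i.
have [[bj fj] /restrictbP[dj du ju] [bu fu]] := hf j.
have nij : ~~ cn st (f i).1 (f j).1.
  by apply/negP => /(bridged_cn bi); apply/negP; apply: fj.
have niu : ~~ cn st (f i).1 (f j).2.
  by apply/negP => /(bridged_cn bi); apply/negP; apply: fu; apply: ltn_trans lt _.
have nju : ~~ cn st (f j).1 (f j).2.
  by apply/negP => /(bridged_cn bj); apply/negP; apply: fu.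
have iu : Nw (f i).1 (f j).2.
  apply/restrictbP; split=> //.
  by rewrite (label_shortcut di dj nij niu nju e).
case/negP: (fu i.+1 lt); apply/bridgedSP; right.
by exists (f i).1, (f j).2; split=> //; apply: cn_refl.
Qed.

End Bound.

(** * The dynamic program *)

(* An edge insertion is a special case of [insert]; only [delE] needs [delete]. *)
Definition update (L : logic) (del : bool) M (E E' : var L -> var L -> form L)
    (ps : seq (var L)) (st : struct L) : struct L :=
  let st1 := foldl (fun s p => touch E p s) st ps in
  if del then
    if ps is [:: a; b] then delete a b E' st1 else st1
  else insert M E' st1.

Notation aux := 'I_4.
Definition sQ : aux := @Ordinal 4 0 isT.
Definition sLe : aux := @Ordinal 4 1 isT.
Definition sC : aux := @Ordinal 4 2 isT.
Definition sS : aux := @Ordinal 4 3 isT.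

Notation fol := (fo_logic (unit + aux)).

Definition fo_edge : nat -> nat -> nat -> fo (unit + aux) :=
  fun l m n => FRel (inl tt) [:: n - l.+1; n - m.+1].

(** [cn] is stored up to reflexivity: auxiliary relations start empty, whereas every element is a
    tree from the outset. *)
Definition fo_struct : struct fol :=
  @Struct fol (fun l m n => FRel (inr sLe) [:: n - l.+1; n - m.+1])
    (fun l m => @Or fol (@Eq fol l m) (fun n => FRel (inr sC) [:: n - l.+1; n - m.+1]))
    (fun l m p n => FRel (inr sS) [:: n - l.+1; n - m.+1; n - p.+1]).

(* Out-of-range variables of the formula are sent to the index n, which is out
   of range in an environment of size n. *)
Fixpoint relevel (vs : seq nat) (mu : fo unit) (n : nat) : fo (unit + aux) :=
  let var i := nth n [seq n - l.+1 | l <- vs] i in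
  match mu with
  | FRel _ args => FRel (inl tt) (map var args)
  | FEq i j => FEq (var i) (var j)
  | FNot f => FNot (relevel vs f n)
  | FAnd f g => FAnd (relevel vs f n) (relevel vs g n)
  | FOr f g => FOr (relevel vs f n) (relevel vs g n)
  | FEx f => FEx (relevel (n :: vs) f n.+1)
  | FAll f => FAll (relevel (n :: vs) f n.+1)
  end.

(** * Correctness of the update formulas *)

Section RepresentUpdate.
Variables (D : finType) (E : rel D) (A : aux -> seq D -> bool).

Definition interp : unit + aux -> seq D -> bool :=
  fun s t => match s with inl _ => graph_interp E tt t | inr i => A i t end.

Definition aux_struct : struct (bool_logic D) :=
  @Struct (bool_logic D) (fun x y => A sLe [:: x; y])
    (fun x y => (x == y) || A sC [:: x; y]) (fun x y z => A sS [:: x; y; z]).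

Fixpoint repvs (w : seq D) (ls : seq nat) (ds : seq D) : Prop :=
  match ls, ds with
  | [::], [::] => True
  | l :: ls', d :: ds' => repv w l d /\ repvs w ls' ds'
  | _, _ => False
  end.

Lemma repvs_prefix w w' ls ds : prefix w w' -> repvs w ls ds -> repvs w' ls ds.
Proof.
move=> p; elim: ls ds => [|l ls IH] [|d ds] //= [h /IH]; split=> //.
exact: repv_prefix h.
Qed.

Lemma repvs_cat w ls ds ls' ds' : repvs w ls ds -> repvs w ls' ds' ->
  repvs w (ls ++ ls') (ds ++ ds').
Proof. by elim: ls ds => [|l ls IH] [|d ds] //= [h /IH h1] /h1. Qed.

Lemma repvs_size w ls ds : repvs w ls ds -> size ls = size ds.
Proof. by elim: ls ds => [|l ls IH] [|d ds] //= [_ /IH ->]. Qed.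

Lemma onth_repvs w ls ds i : repvs w ls ds ->
  onth (rev w) (nth (size w) [seq size w - l.+1 | l <- ls] i) = onth ds i.
Proof.
elim: ls ds i => [|l ls IH] [|d ds] i //=.
  by rewrite nth_nil onth0n onth_default ?size_rev.
by case=> h1 h2; case: i => [|i] /=; [exact: repv_rev|exact: IH].
Qed.

Lemma rep_relevel w ls ds mu : repvs w ls ds ->
  rep0 interp w (relevel ls mu) (eval (graph_interp E) ds mu).
Proof.
rewrite /rep0; elim: mu w ls ds => [[] args|i j|f IH|f IHf g IHg|f IHf g IHg|f IH|f IH] w ls ds h.
- rewrite /=; set args' := map _ args.
  suff -> : lookup_all (rev w) args' = lookup_all ds args by [].
  by rewrite /args'; elim: args {args'} => //= i args ->; rewrite (onth_repvs _ h).
- by rewrite /= !(onth_repvs _ h).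
- by rewrite /= (IH _ _ _ h).
- by rewrite /= (IHf _ _ _ h) (IHg _ _ _ h).
- by rewrite /= (IHf _ _ _ h) (IHg _ _ _ h).
- rewrite /=; apply: eq_existsb => d.
  rewrite -(IH (rcons w d) (size w :: ls)) ?rev_rcons ?size_rcons //=; split.
    by rewrite /repv -cats1 onth_cat ltnn subnn.
  by apply: repvs_prefix h; rewrite -cats1 prefix_prefix.
- rewrite /=; apply: eq_forallb => d.
  rewrite -(IH (rcons w d) (size w :: ls)) ?rev_rcons ?size_rcons //=; split.
    by rewrite /repv -cats1 onth_cat ltnn subnn.
  by apply: repvs_prefix h; rewrite -cats1 prefix_prefix.
Qed.

Lemma rep_define w ps a mu : repvs w ps a ->
  rep2 interp w (fun l m => relevel (ps ++ [:: l; m]) mu) (define mu a E).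
Proof.
move=> h w' l x m y p hl hm; apply: rep_relevel; apply: repvs_cat => //.
exact: repvs_prefix h.
Qed.

Lemma rep_edge w : rep2 interp w fo_edge E.
Proof.
move=> w' l x m y p hl hm.
by rewrite /rep0 /= (repv_rev hl) (repv_rev hm).
Qed.

Lemma rep_aux_struct w : rep_struct interp w fo_struct aux_struct.
Proof.
split.
- move=> w' l x m y p hl hm.
  by rewrite /rep0 /= (repv_rev hl) (repv_rev hm).
- move=> w' l x m y p hl hm.
  by rewrite /rep0 /= (repv_rev hl) (repv_rev hm).
- move=> w' l x m y n z p hl hm hn.
  by rewrite /rep0 /= (repv_rev hl) (repv_rev hm) (repv_rev hn).
Qed.

Lemma rep_update w del M ps a mu : repvs w ps a ->
  rep_struct interp w
    (update (L := fol) del M fo_edge (fun l m => relevel (ps ++ [:: l; m]) mu) ps fo_struct)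
    (update (L := bool_logic D) del M E (define mu a E) a aux_struct).
Proof.
move=> h; rewrite /update.
have hE' := rep_define mu h.
have : rep_struct interp w (foldl (fun s p => touch (L := fol) fo_edge p s) fo_struct ps)
    (foldl (fun s p => touch (L := bool_logic D) E p s) aux_struct a).
  have := rep_aux_struct w; move: fo_struct aux_struct h {hE'}.
  elim: ps a => [|p ps IH] [|d a] //= s s' [hp hps] hs; apply: IH => //.
  by apply: rep_touch => //; apply: rep_edge.
move: (foldl _ _ _) (foldl _ _ _) => s s' hs.
case: del; last exact: rep_insert.
have := repvs_size h.
case: ps a h hE' => [|p [|q [|r ps]]] [|d [|d' [|d'' a]]] //= [hp [hq _]] hE' _.
exact: rep_delete.
Qed.

Lemma repvs_iota (w pre a post : seq D) : rev w = pre ++ a ++ post ->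
  repvs w [seq size w - i.+1 | i <- iota (size pre) (size a)] a.
Proof.
elim: a pre => [|d a IH] pre //= e; split; last first.
  by have := IH (rcons pre d); rewrite cat_rcons size_rcons; apply.
have lt : size pre < size w.
  by rewrite -(size_rev w) e size_cat /= addnS ltnS leq_addr.
have := @onth_rev_level _ (rev w) (size pre); rewrite /repv size_rev revK => -> //.
by rewrite e onth_cat ltnn subnn.
Qed.

End RepresentUpdate.

Section UpdateGood.
Variables (D : finType) (E : rel D) (st : struct (bool_logic D)).
Hypotheses (sE : symmetric E) (gd : good E st).

Lemma touches_good (a : seq D) :
  let st1 := foldl (fun s p => touch (L := bool_logic D) E p s) st a in
  good E st1 /\ all (domb st1) a.
Proof.
rewrite /=; elim/last_ind: a => [|a p [IHg IHa]]; first by [].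
rewrite foldl_rcons all_rcons.
have [g dp mono] := touch_good p sE IHg.
by split=> //; rewrite dp; apply: sub_all IHa.
Qed.

(** Formulas are invariant under automorphisms that fix their parameters, and touched parameters are
    fixed by transpositions of untouched elements. *)
Lemma define_hom mu (a : seq D) u v : all (domb st) a ->
  ~~ domb st u -> ~~ domb st v ->
  forall x y, define mu a E (tperm u v x) (tperm u v y) = define mu a E x y.
Proof.
move=> da nu nv x y; rewrite /define.
rewrite -(@eval_perm _ _ (tperm u v) mu (a ++ [:: x; y]) (good_hom gd nu nv)).
rewrite map_cat /=; congr eval; congr cat; rewrite -[LHS]map_id.
apply/eq_in_map => p /(allP da) dp; rewrite tpermD //.
- by apply: contra nu => /eqP->.
- by apply: contra nv => /eqP->.
Qed.

End UpdateGood.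

Definition rule_of (q : rquery) : fo unit :=
  if rq_rule q is Some mu then mu else FRel tt [:: rq_ar q; (rq_ar q).+1].

Lemma eval_old (D : finType) (E : rel D) (a : seq D) x y :
  eval (graph_interp E) (a ++ [:: x; y]) (FRel tt [:: size a; (size a).+1]) = E x y.
Proof.
by rewrite eval_FRel_graph !onth_cat ltnn ltnNge leqnSn subnn subSnn.
Qed.

Lemma apply_rqE q (D : finType) (a : seq D) (E : rel D) :
  size a = rq_ar q -> apply_rq q a E = define (rule_of q) a E.
Proof.
move=> sa; apply: functional_extensionality => x; apply: functional_extensionality => y.
rewrite /apply_rq /define /rule_of; case: rq_rule => //.
by rewrite -sa eval_old.
Qed.

Lemma insertion_sub q (D : finType) (a : seq D) (E : rel D) :
  is_insertion q -> size a = rq_ar q -> subrel E (define (rule_of q) a E).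
Proof.
rewrite /is_insertion /define /rule_of => iq sa x y e.
case: (rq_rule q) iq => [mu [phi ->]|_]; rewrite -sa.
  by rewrite -[eval _ _ _]/(eval _ _ (FRel tt _) || _) eval_old e.
by rewrite eval_old.
Qed.

Lemma define_delE (D : finType) (a b : D) (E : rel D) :
  define (rule_of delE) [:: a; b] E =2 delb E a b.
Proof. by move=> x y; rewrite /define /delb /del /same_edge /=. Qed.

Lemma update_good (D : finType) (E : rel D) st (q : rquery) (del : bool) (a : seq D) :
  (if del then q = delE else is_insertion q) ->
  symmetric E -> good E st -> size a = rq_ar q -> symmetric (define (rule_of q) a E) ->
  good (define (rule_of q) a E)
    (update (L := bool_logic D) del (bridge_bound (rule_of q) (rq_ar q)) E
       (define (rule_of q) a E) a st).
Proof.
move=> hq sE gd sa sE'; rewrite /update.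
have [g da] := touches_good sE gd a; move: (foldl _ _ _) g da => st1 g da.
have hom u v := define_hom g (rule_of q) (u := u) (v := v) da.
case: del hq => [eq|iq].
  rewrite eq in sa sE' hom *; case: a sa sE' da hom => [|p [|p' [|]]] // _ sE' da hom.
  by apply: delete_good => // x y; rewrite define_delE.
apply: insert_good => //; first exact: insertion_sub.
  exact: g.
exact: bridge_boundP.
Qed.

Lemma In_nth T (d : T) (s : seq T) i : i < size s -> List.In (nth d s i) s.
Proof.
elim: s i => [//|x s IH] [|i] /=; first by left.
by move=> h; right; apply: IH.
Qed.

Section Program.
Variable Delta : seq rquery.
Let qs := Delta ++ [:: insE; delE].

Definition arity (i : aux) : nat := if i == sS then 3 else 2.

(** Index [(size Delta).+1] is the place of [delE] in [qs]. Levels count from the end of the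
    environment, so the parameter at position [i] has level [n - i.+1]. *)
Definition new_struct (j : 'I_(size qs)) (ar : nat) : struct fol :=
  let q := nth dummy_rq qs j in
  let n := rq_ar q + ar in
  let ps := [seq n - i.+1 | i <- iota 0 (rq_ar q)] in
  update (L := fol) (j == (size Delta).+1 :> nat)
    (bridge_bound (rule_of q) (rq_ar q)) fo_edge
    (fun l m => relevel (ps ++ [:: l; m]) (rule_of q)) ps fo_struct.

Definition new_edge (j : 'I_(size qs)) (ar l m : nat) : nat -> fo (unit + aux) :=
  let q := nth dummy_rq qs j in
  let n := rq_ar q + ar in
  relevel ([seq n - i.+1 | i <- iota 0 (rq_ar q)] ++ [:: l; m]) (rule_of q).

(** The last tuple entry has level 0, hence the first has [arity i - 1]. The query formula needs the
    graph after the change, but is evaluated in the old state; [new_edge] defines the former in the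
    latter. *)
Definition upd (j : 'I_(size qs)) (i : aux) : fo (unit + aux) :=
  let n := rq_ar (nth dummy_rq qs j) + arity i in
  let x := arity i - 1 in let y := arity i - 2 in let z := arity i - 3 in
  let st := new_struct j (arity i) in
  if i == sQ then connected (L := fol) (new_edge j (arity i)) st x y n
  else if i == sLe then le st x y n
  else if i == sC then cn st x y n
  else sd st x y z n.

Definition program : dynprog (size qs) :=
  @DynProg (size qs) 4 arity upd sQ erefl.

Hypothesis HDelta : forall q, List.In q Delta -> is_insertion q.

Lemma query_kind (j : 'I_(size qs)) :
  if j == (size Delta).+1 :> nat then nth dummy_rq qs j = delE
  else is_insertion (nth dummy_rq qs j).
Proof.
case: j => j; rewrite [size qs]size_cat /= addn2 ltnS leq_eqVlt.
case: eqP => [->|ne] /=; first by rewrite /qs nth_cat ltnNge leqnSn /= subSnn.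
rewrite ltnS leq_eqVlt => /orP[/eqP->|lt].
  by rewrite /qs nth_cat ltnn subnn /=; exists edge_or_rev.
by rewrite /qs nth_cat lt; apply: HDelta; apply: In_nth.
Qed.

Section Step.
Variables (D : finType) (E : rel D) (A : aux_db program D) (j : 'I_(size qs)) (a : seq D).
Let q := nth dummy_rq qs j.
Hypothesis sa : size a = rq_ar q.
Let st' := update (L := bool_logic D) (j == (size Delta).+1 :> nat)
  (bridge_bound (rule_of q) (rq_ar q)) E (define (rule_of q) a E) a
  (aux_struct A).
Let A' : aux_db program D := (step (E, A) (j, a)).2.

Lemma rep_new (t : seq D) (w := rev (a ++ t)) :
  [/\ repvs w [seq rq_ar q + size t - i.+1 | i <- iota 0 (rq_ar q)] a,
      repvs w [seq size t - i.+1 | i <- iota 0 (size t)] t,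
      rep_struct (interp E A) w (new_struct j (size t)) st' &
      rep2 (interp E A) w (new_edge j (size t)) (define (rule_of q) a E)].
Proof.
have sw : size w = rq_ar q + size t by rewrite size_rev size_cat sa.
have h1 : repvs w [seq size w - i.+1 | i <- iota 0 (size a)] a.
  by apply: (repvs_iota (pre := [::]) (post := t)); rewrite revK.
have h2 : repvs w [seq size w - i.+1 | i <- iota (size a) (size t)] t.
  by apply: (repvs_iota (post := [::])); rewrite revK cats0.
rewrite sw sa in h1; rewrite sw sa in h2.
have e : [seq rq_ar q + size t - i.+1 | i <- iota (rq_ar q) (size t)] =
    [seq size t - i.+1 | i <- iota 0 (size t)].
  rewrite -[in iota _ _](addn0 (rq_ar q)) iotaDl -map_comp.
  by apply: eq_map => i; rewrite /= -addnS subnDl.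
rewrite e in h2.
by split=> //; [exact: rep_update|exact: rep_define].
Qed.

Lemma evalE (t : seq D) f : eval (prog_interp E A) (a ++ t) (f (rq_ar q + size t)) =
  eval (interp E A) (rev (rev (a ++ t))) (f (size (rev (a ++ t)))).
Proof. by rewrite revK size_rev size_cat sa. Qed.

Lemma step_aux i (t : seq D) : size t = arity i ->
  A' i t = eval (prog_interp E A) (a ++ t) (upd j i).
Proof. by move=> sz; rewrite /A' /= sz eqxx. Qed.

(** Reflexivity of the new [cn] absorbs the disjunct [x == y] that [aux_struct] adds when reading
    the stored relation. *)
Lemma step_aux_struct : (forall x, cn st' x x) -> aux_struct A' = st'.
Proof.
move=> refl.
have [le_eq cn_eq sd_eq] : [/\ forall x y, A' sLe [:: x; y] = le st' x y,
    forall x y, A' sC [:: x; y] = cn st' x y &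
    forall x y z, A' sS [:: x; y; z] = sd st' x y z].
  split=> [x y|x y|x y z]; rewrite step_aux // /upd.
  - have [_ [hx [hy _]] [h _ _] _] := rep_new [:: x; y].
    by have := h _ _ _ _ _ (prefix_refl _) hx hy; rewrite /rep0 -evalE.
  - have [_ [hx [hy _]] [_ h _] _] := rep_new [:: x; y].
    by have := h _ _ _ _ _ (prefix_refl _) hx hy; rewrite /rep0 -evalE.
  - have [_ [hx [hy [hz _]]] [_ _ h] _] := rep_new [:: x; y; z].
    by have := h _ _ _ _ _ _ _ (prefix_refl _) hx hy hz; rewrite /rep0 -evalE.
rewrite /aux_struct; case: st' refl le_eq cn_eq sd_eq => l c s refl hl hc hs.
congr Struct; apply: functional_extensionality => x; apply: functional_extensionality => y.
- exact: hl.
- by rewrite hc; case: eqP => //= ->; apply/esym/refl.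
- by apply: functional_extensionality => z; apply: hs.
Qed.

Lemma step_query x y : A' sQ [:: x; y] = connected (L := bool_logic D) (define (rule_of q) a E) st' x y.
Proof.
rewrite step_aux // /upd.
have [_ [hx [hy _]] hs hE] := rep_new [:: x; y].
by have := rep_connected hE hs (prefix_refl _) hx hy; rewrite /rep0 -evalE.
Qed.

End Step.

Lemma good_empty (D : finType) :
  good (fun _ _ => false) (aux_struct (fun (_ : aux) (_ : seq D) => false)).
Proof.
have cE (G : rel D) x y : G =2 (fun _ _ => false) -> (x == y) || false = connect G x y.
  move=> G0; rewrite orbF; apply/eqP/idP => [->|]; first exact: connect0.
  move: x y; apply: connect_rind => // x y z _; by rewrite G0.
split=> //=.
- split=> //.
  by move=> x y; apply: cE.
- by move=> x y; apply: cE => u v; rewrite /restrictb /restrict /= ?andbF.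
Qed.

Lemma run_rcons (D : finType) (alpha : seq ('I_(size qs) * seq D)) c :
  run program (rcons alpha c) = step (run program alpha) c.
Proof. exact: foldl_rcons. Qed.

(** The structure is good from the start, but the query relation is right only after a change: it is
    initially empty, while reachability is reflexive. *)
Lemma run_good (D : finType) (alpha : seq ('I_(size qs) * seq D)) :
  (forall c, List.In c alpha -> size c.2 = rq_ar (nth dummy_rq qs c.1)) ->
  (forall n, n <= size alpha -> symmetric (run program (take n alpha)).1) ->
  good (run program alpha).1 (aux_struct (run program alpha).2) /\
  (0 < size alpha -> forall t,
     (run program alpha).2 sQ t = reach (run program alpha).1 t).
Proof.
elim/last_ind: alpha => [|alpha [j a] IH] har hsym.
  by split=> //; apply: good_empty.
have hin c : List.In c alpha -> List.In c (rcons alpha (j, a)).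
  by rewrite -cats1 => h; apply/List.in_or_app; left.
have sa : size a = rq_ar (nth dummy_rq qs j).
  by apply: (har (j, a)); rewrite -cats1; apply/List.in_or_app; right; left.
have sE := hsym (size alpha); rewrite size_rcons leqnSn -cats1 take_size_cat // in sE.
have sE' := hsym (size alpha).+1.
rewrite -(size_rcons alpha (j, a)) take_size leqnn run_rcons in sE'.
have [|n le|gd _] := IH.
- by move=> c /hin/har.
- have := hsym n; rewrite size_rcons -cats1 takel_cat //; apply; exact: leqW.
rewrite run_rcons.
case: (run program alpha) gd sE sE' => E A gd /(_ isT) sE /(_ isT) sE' {IH hin har hsym}.
have eE : (step (E, A) (j, a)).1 = define (rule_of (nth dummy_rq qs j)) a E.
  by rewrite /= apply_rqE.
rewrite eE in sE'; rewrite !eE.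
have g := update_good (query_kind j) sE gd sa sE'.
rewrite (step_aux_struct sa); last by move=> x; rewrite (good_cn g) connect0.
split=> // _ t; case: t => [|x [|y [|z t]]] //.
by rewrite (step_query E A sa) (connectedE sE' g).
Qed.

End Program.

Theorem theorem4p1 (Delta : seq rquery)
  (HDelta : forall q, List.In q Delta -> is_insertion q) :
  DynFO_reach_undirected (Delta ++ [:: insE; delE]).
Proof.
exists (program Delta) => D alpha nonempty har hsym.
exact: (run_good HDelta har hsym).2.
Qed.
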